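(* For all $a_0,a_1,a_2,b_0,b_1,b_2\in\mathbb{R}$, the equation $$\frac{dx}{dt}=(a_0+a_1t+a_2t^2)x^3+(b_0+b_1t+b_2t^2)x^2,\qquad t\in[0,1],$$ has at most three limit cycles (including $x=0$, i.e., the solution $x\equiv 0$ is counted when it is a limit cycle). Moreover, this upper bound is sharp, i.e., there exist parameters $a_0,a_1,a_2,b_0,b_1,b_2\in\mathbb{R}$ for which the equation has exactly three limit cycles (including $x=0$).
   Context: A closed solution is a solution $x(t)$ defined on all of $[0,1]$ with $x(0)=x(1)$. A limit cycle is a closed solution that is isolated among the closed solutions. *)

(* Defs.v *)
From Stdlib Require Import Reals List.
Open Scope R_scope.

Definition I01 (t : R) : Prop := 0 <= t <= 1.

(* Functions on [0,1] are represented by functions on R, of which only the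
   values on [0,1] are meaningful; this is equality of functions on [0,1]. *)
Definition eq01 (x y : R -> R) : Prop := forall t, I01 t -> x t = y t.

(* x solves dx/dt = f(t, x) on [0,1].  D_in is the derivative relative to
   [0,1], hence one-sided at 0 and at 1. *)
Definition is_solution (f : R -> R -> R) (x : R -> R) : Prop :=
  forall t, I01 t -> D_in x (fun s => f s (x s)) I01 t.

Definition closed_solution (f : R -> R -> R) (x : R -> R) : Prop :=
  is_solution f x /\ x 0 = x 1.

(* "Isolated" refers to uniform distance on [0,1]. *)
Definition limit_cycle (f : R -> R -> R) (x : R -> R) : Prop :=
  closed_solution f x /\
  exists eps, 0 < eps /\
    forall y, closed_solution f y ->
      (forall t, I01 t -> Rabs (y t - x t) < eps) -> eq01 y x.

Definition pairwise_distinct (l : list (R -> R)) : Prop :=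
  ForallOrdPairs (fun x y => ~ eq01 x y) l.

(* Both counts are of functions on [0,1], i.e. modulo eq01. *)
Definition at_most (n : nat) (P : (R -> R) -> Prop) : Prop :=
  forall l, Forall P l -> pairwise_distinct l -> (length l <= n)%nat.

Definition exactly (n : nat) (P : (R -> R) -> Prop) : Prop :=
  exists l, length l = n /\ pairwise_distinct l /\
    forall x, P x <-> Exists (eq01 x) l.

Definition abel (a0 a1 a2 b0 b1 b2 : R) (t x : R) : R :=
  (a0 + a1 * t + a2 * t ^ 2) * x ^ 3 + (b0 + b1 * t + b2 * t ^ 2) * x ^ 2.

(* Main.v *)
Require Import Defs.
From Stdlib Require Import Reals List Lra Lia Classical ClassicalEpsilon.
From Coquelicot Require Import Coquelicot.
Open Scope R_scope.

(** Write the equation as x' = A x^3 + B x^2.  By uniqueness a solution other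
than 0 never vanishes, and its reciprocal u = 1/x satisfies
u' = -(A/u + B).  The bound amounts to: at most two limit cycles differ from
0.  Everything depends on the wronskian V = A B' - A' B, which has degree at
most 2 because A and B do.

If V vanishes identically, A and B are proportional and the equation separates
as x' = beta(t) h(x).  The flow of the autonomous equation x' = h(x) then maps
solutions to solutions and closed ones to closed ones, so a closed solution
along which h has no zero is never isolated
([separable_not_isolated]).  Besides 0 this leaves at most one constant solution.

If V vanishes at t0 but not identically, some combination of A and B equals
g (t - t0)^2 with g <> 0 ([double_root_combination]).  When A + cB has constant
sign, closed solutions do not meet the line u = c, and for
Y(u) = u + c ln|u - c| one has
  (Y(u1) - Y(u2))' = (A + cB) (u1 - u2) / ((u1 - c) (u2 - c)),
so Y(u1) - Y(u2) is strictly monotone and u1, u2 cannot both be closed.  When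
it is B that has constant sign, u^2 takes the place of Y.

The main case is a wronskian without real roots.  The reflection x -> -x changes
its sign, so let V > 0; then B/A is increasing wherever A has no zero.  Suppose
that there are three closed solutions besides 0, and let u1 < u2 be reciprocals
of two that have the same sign.  The quantity p = ln(u2 - u1) satisfies
p' = A/(u1 u2), hence it increases on one arc of the circle [0,1]/(0 = 1) and
decreases on the complementary arc: A has at most two zeros, and if it has only
one in (0,1), the cut 0 = 1 is the other turning point.  If it has none, p is
monotone, which is absurd.  Use p as the parameter s on both arcs, which then
run between the same two end points.  In this parameter the equations for
(u1, u2, u3) depend on time only through kappa = B/A, and the difference of
kappa between the two arcs is increasing in s.  A comparison gives
u1/u2 larger on the rising arc than on the falling one, strictly inside.
The affine coordinate z = (u3 - u2)/(u2 - u1) of the third solution satisfies an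
equation in (u1/u2, z) alone, monotone in u1/u2, so z starts equal on the two
arcs and must end different: a contradiction ([three_solution_core]).  At the
cut, when it is interior to an arc, kappa jumps in the right direction because
B(1)/A(1) < B(0)/A(0) as soon as A has two zeros in (0,1) ([ratio_across_cut]).

For sharpness take A = t - 1/2 and B = be + 12 (t - 1/2)^2; the equation is then
invariant under (t, x) -> (1 - t, -x).  The closing condition u(0) = u(1) determines be
from u, so a closed positive solution together with its parameter be is a fixed
point of a contraction ([symmetric_family_closed]); the symmetry turns it into a
negative one.  As there are then exactly three closed solutions, each is
isolated. *)

(** * Derivatives and continuity of real functions *)

Lemma derive_eq (f : R -> R) (t a b : R) : is_derive f t a -> a = b -> is_derive f t b.
Proof. intros h <-. exact h. Qed.

Lemma derive_unique (f : R -> R) (t a b : R) : is_derive f t a -> is_derive f t b -> a = b.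
Proof. intros h1 h2. apply is_derive_unique in h1, h2. congruence. Qed.

Lemma derive_const (c t : R) : is_derive (fun _ => c) t 0.
Proof. apply is_derive_Reals, derivable_pt_lim_const. Qed.

Lemma derive_plus (f g : R -> R) (t a b : R) :
  is_derive f t a -> is_derive g t b -> is_derive (fun s => f s + g s) t (a + b).
Proof. rewrite !is_derive_Reals. apply derivable_pt_lim_plus. Qed.

Lemma derive_minus (f g : R -> R) (t a b : R) :
  is_derive f t a -> is_derive g t b -> is_derive (fun s => f s - g s) t (a - b).
Proof. rewrite !is_derive_Reals. apply derivable_pt_lim_minus. Qed.

Lemma derive_mult (f g : R -> R) (t a b : R) :
  is_derive f t a -> is_derive g t b ->
  is_derive (fun s => f s * g s) t (a * g t + f t * b).
Proof. rewrite !is_derive_Reals. apply derivable_pt_lim_mult. Qed.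

Lemma derive_comp (f g : R -> R) (t a b : R) :
  is_derive f (g t) a -> is_derive g t b -> is_derive (fun s => f (g s)) t (a * b).
Proof.
rewrite !is_derive_Reals. intros hf hg. now apply (derivable_pt_lim_comp g f).
Qed.

Lemma derive_ln_abs (f : R -> R) (t a : R) :
  f t <> 0 -> is_derive f t a -> is_derive (fun s => ln (Rabs (f s))) t (a / f t).
Proof.
intros h d.
apply (derive_eq _ _ (/ Rabs (f t) * (a * sign (f t)))).
- apply (derive_comp ln (fun s => Rabs (f s))).
  + apply is_derive_ln, Rabs_pos_lt, h.
  + rewrite Rmult_comm. now apply is_derive_Rabs.
- destruct (Rlt_or_le (f t) 0) as [n|n].
  + rewrite Rabs_left, sign_eq_m1 by lra. field. exact h.
  + rewrite Rabs_pos_eq, sign_eq_1 by lra. field. exact h.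
Qed.

Lemma continuity_ln_abs f :
  continuity f -> (forall t, f t <> 0) -> continuity (fun t => ln (Rabs (f t))).
Proof.
intros cf h t. apply (continuity_pt_comp (fun t => Rabs (f t)) ln).
- apply (continuity_comp f Rabs); [exact cf|exact Rcontinuity_abs].
- apply derivable_continuous_pt. exists (/ Rabs (f t)).
  apply derivable_pt_lim_ln, Rabs_pos_lt, h.
Qed.

Lemma derive_primitive f : continuity f -> forall v, is_derive (fun v => RInt f 0 v) v (f v).
Proof.
intros cf v.
assert (c : forall w, continuous f w).
{ intro w. apply continuity_pt_filterlim, cf. }
apply (is_derive_RInt f (fun v => RInt f 0 v) 0 v); [|apply c].
apply filter_forall. intro w. apply (RInt_correct f).
apply ex_RInt_continuous. intros r _. apply c.
Qed.

Lemma derive_continuity f f' : (forall t : R, is_derive f t (f' t : R)) -> continuity f.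
Proof.
intros d t. apply derivable_continuous_pt, ex_derive_Reals_0. exists (f' t). apply d.
Qed.

Ltac cont :=
  repeat (first
    [ assumption
    | apply continuity_const; intros ? ?; reflexivity
    | apply continuity_plus | apply continuity_minus | apply continuity_opp
    | apply continuity_mult
    | apply continuity_div | apply continuity_inv ]).

Lemma continuity_bounded f a b :
  a <= b -> continuity f -> exists M, forall t, a <= t <= b -> Rabs (f t) <= M.
Proof.
intros hab cf.
destruct (continuity_ab_maj (fun t => Rabs (f t)) a b hab) as [x [hx _]].
- intros t _. apply (continuity_comp f Rabs); [exact cf|exact Rcontinuity_abs].
- exists (Rabs (f x)). exact hx.
Qed.

Lemma continuity_near f t eps :
  continuity f -> 0 < eps ->
  exists d, 0 < d /\ forall s, Rabs (s - t) < d -> Rabs (f s - f t) < eps.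
Proof.
intros cf he. destruct (cf t eps he) as [d [hd h]].
exists d; split; [exact hd|]. intros s hs.
destruct (Req_dec t s) as [<-|ne].
- rewrite Rminus_diag, Rabs_R0. exact he.
- apply (h s). split; [split; [exact I|exact ne]|exact hs].
Qed.

Lemma constant_sign f s t :
  continuity f -> (forall r, f r <> 0) -> 0 < f s * f t.
Proof.
intros cf nz.
assert (W : forall s t, s < t -> 0 < f s * f t).
{ clear s t. intros s t h.
  destruct (Rlt_or_le 0 (f s * f t)) as [k|k]; [exact k|exfalso].
  destruct (IVT_cor f s t cf ltac:(lra) k) as [r [_ hr]]. exact (nz r hr). }
destruct (Rtotal_order s t) as [h|[->|h]].
- apply W, h.
- specialize (nz t). nra.
- rewrite Rmult_comm. apply W, h.
Qed.

Lemma mean_value f a b :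
  a < b -> continuity f -> (forall t, a < t < b -> ex_derive f t) ->
  exists c l, a < c < b /\ is_derive f c l /\ f b - f a = l * (b - a).
Proof.
intros hab cf df.
assert (pr1 : forall c, a < c < b -> derivable_pt f c).
{ intros c hc. apply ex_derive_Reals_0, df, hc. }
assert (pr2 : forall c, a < c < b -> derivable_pt id c).
{ intros c _. apply derivable_pt_id. }
destruct (MVT f id a b pr1 pr2 hab) as [c [hc e]].
- intros; apply cf.
- intros; apply derivable_continuous_pt, derivable_pt_id.
- exists c, (Derive f c). split; [exact hc|]. split; [apply Derive_correct, df, hc|].
  rewrite <- (Derive_Reals f c (pr1 c hc)).
  rewrite (derive_pt_eq_0 id c 1 (pr2 c hc)) in e by apply derivable_pt_lim_id.
  unfold id in e. lra.
Qed.

Definition clamp (a b t : R) : R := Rmax a (Rmin t b).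

Lemma clamp_id a b t : a <= t <= b -> clamp a b t = t.
Proof. intro h. unfold clamp, Rmax, Rmin. repeat destruct Rle_dec; lra. Qed.

Lemma clamp_in a b t : a <= b -> a <= clamp a b t <= b.
Proof. intro h. unfold clamp, Rmax, Rmin. repeat destruct Rle_dec; lra. Qed.

Lemma clamp_contract a b s t : a <= b -> Rabs (clamp a b s - clamp a b t) <= Rabs (s - t).
Proof.
intro h. unfold clamp, Rmax, Rmin.
repeat destruct Rle_dec; unfold Rabs; repeat destruct Rcase_abs; lra.
Qed.

Lemma clamp_continuity a b : a <= b -> continuity (clamp a b).
Proof.
intros h t eps he. exists eps; split; [exact he|]. intros s [_ hs].
unfold dist in *; simpl in *; unfold R_dist in *.
apply Rle_lt_trans with (2 := hs). apply clamp_contract, h.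
Qed.

(** * Differential inequalities and inverse functions *)

(** Where f is negative, f exp(-lam t) increases, so f cannot become negative; and
where f is nonnegative, f exp(lam t) increases strictly. *)
Lemma barrier_smooth f a b lam :
  continuity f -> 0 <= f a ->
  (forall t, a < t < b -> exists l, is_derive f t l /\ - lam * Rabs (f t) < l) ->
  forall t, a < t <= b -> 0 < f t.
Proof.
intros cf fa df.
assert (mono : forall mu e t, a <= e -> e < t -> t <= b ->
   (forall s, e < s < t -> mu * f s <= lam * - Rabs (f s)) ->
   f e * exp (- mu * e) < f t * exp (- mu * t)).
{ intros mu e t ae et tb hs.
  destruct (mean_value (fun s => f s * exp (- mu * s)) e t) as [c [l' [hc [hl' eq]]]].
  - exact et.
  - apply continuity_mult; [exact cf|]. intro s.
    apply derivable_continuous_pt. apply ex_derive_Reals_0. auto_derive. exact I.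
  - intros s hs'. destruct (df s ltac:(lra)) as [l [hl _]].
    apply ex_derive_mult; [exists l; exact hl|]. auto_derive. exact I.
  - destruct (df c ltac:(lra)) as [l [hl hl2]].
    assert (D : is_derive (fun s => f s * exp (- mu * s)) c ((l - mu * f c) * exp (- mu * c))).
    { apply (derive_eq _ _ (l * exp (- mu * c) + f c * (- mu * exp (- mu * c)))); [|ring].
      apply (derive_mult f (fun s => exp (- mu * s))); [exact hl|]. auto_derive; [exact I|ring]. }
    apply is_derive_unique in D, hl'. assert (el := eq_trans (eq_sym hl') D). simpl in el. rewrite el in eq.
    specialize (hs c hc).
    assert (0 < (l - mu * f c) * exp (- mu * c) * (t - e)).
    { apply Rmult_lt_0_compat; [apply Rmult_lt_0_compat|lra]; [lra|apply exp_pos]. }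
    lra. }
assert (nn : forall t, a < t <= b -> 0 <= f t).
{ intros t2 h2. destruct (Rle_or_lt 0 (f t2)) as [h|neg]; [exact h|exfalso].
  (* the last nonnegative point before t2 *)
  destruct (completeness (fun t => a <= t <= t2 /\ 0 <= f t)) as [e [ub lub]].
  - exists t2. intros x [[_ hx] _]. exact hx.
  - exists a. split; [lra|exact fa].
  - assert (ae : a <= e) by (apply ub; split; [lra|exact fa]).
    assert (et : e <= t2) by (apply lub; intros x [[_ hx] _]; exact hx).
    assert (fe : 0 <= f e).
    { destruct (Rle_or_lt 0 (f e)) as [h|ne]; [exact h|exfalso].
      destruct (continuity_near f e (- f e)) as [d [hd hn]]; [exact cf|lra|].
      assert (e <= e - d); [|lra]. apply lub. intros x hx.
      assert (hxe := ub x hx). destruct hx as [hx1 hx2].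
      destruct (Rle_or_lt x (e - d)) as [h|h]; [exact h|exfalso].
      assert (Rabs (x - e) < d) by (apply Rabs_def1; lra).
      specialize (hn x H). apply Rabs_def2 in hn. lra. }
    assert (et' : e < t2) by (destruct et as [h|h]; [exact h|subst; lra]).
    assert (M := mono lam e t2 ae et' (proj2 h2)).
    assert (f e * exp (- lam * e) < f t2 * exp (- lam * t2)).
    { apply M. intros s hs. rewrite Rabs_left; [lra|].
      destruct (Rle_or_lt 0 (f s)) as [h|h]; [exfalso|exact h].
      assert (s <= e); [|lra]. apply ub. split; [lra|exact h]. }
    assert (p1 := exp_pos (- lam * e)). assert (p2 := exp_pos (- lam * t2)). nra. }
intros t ht.
assert (M : f a * exp (- - lam * a) < f t * exp (- - lam * t)).
{ apply mono; [lra|lra|lra|]. intros s hs. rewrite Rabs_pos_eq; [lra|]. apply nn; lra. }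
assert (p1 := exp_pos (- - lam * a)). assert (p2 := exp_pos (- - lam * t)). nra.
Qed.

(** The exceptional point m accommodates a double root of a coefficient, and the
cut of a function continued periodically, where derivatives jump. *)
Lemma barrier f a b m lam :
  continuity f -> 0 <= f a ->
  (forall t, a < t < b -> t <> m -> exists l, is_derive f t l /\ - lam * Rabs (f t) < l) ->
  forall t, a < t <= b -> 0 < f t.
Proof.
intros cf fa df.
destruct (classic (a < m < b)) as [hm|hm].
- assert (L : forall t, a < t <= m -> 0 < f t).
  { apply barrier_smooth with lam; auto. intros; apply df; lra. }
  assert (fm : 0 < f m) by (apply L; lra).
  intros t ht. destruct (Rle_or_lt t m) as [h|h]; [apply L; lra|].
  apply (barrier_smooth f m b lam); auto; [lra|intros; apply df; lra|lra].
- apply barrier_smooth with lam; auto. intros t ht. apply df; [exact ht|]. intros ->. auto.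
Qed.

Lemma barrier_rev f a b m lam :
  continuity f -> 0 <= f b ->
  (forall t, a < t < b -> t <> m -> exists l, is_derive f t l /\ l < lam * Rabs (f t)) ->
  forall t, a <= t < b -> 0 < f t.
Proof.
intros cf fb df t ht.
replace (f t) with ((fun s => f (- s)) (- t)) by (cbv beta; f_equal; lra).
apply (barrier (fun s => f (- s)) (- b) (- a) (- m) lam).
- apply (continuity_comp (fun s => - s) f); [|exact cf].
  apply continuity_opp, derivable_continuous, derivable_id.
- rewrite Ropp_involutive. exact fb.
- intros s hs ne. destruct (df (- s)) as [l [hl hl2]]; [lra|lra|].
  exists (- l); split; [|lra].
  apply (derive_eq _ _ (l * -1)); [|ring].
  apply (derive_comp f (fun s => - s)); [exact hl|]. auto_derive; auto.
- lra.
Qed.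

Lemma strict_increase f a b m :
  a < b -> continuity f ->
  (forall t, a < t < b -> t <> m -> exists l, is_derive f t l /\ 0 < l) ->
  f a < f b.
Proof.
intros hab cf df.
assert (0 < f b - f a); [|lra].
apply (barrier (fun t => f t - f a) a b m 0).
- apply continuity_minus; [exact cf|]. apply continuity_const. intros x y; reflexivity.
- lra.
- intros t ht ne. destruct (df t ht ne) as [l [hl hl2]]. exists l; split; [|lra].
  apply (derive_eq _ _ (l - 0)); [|ring].
  apply derive_minus; [exact hl|apply derive_const].
- lra.
Qed.

(** The change of time used to parametrize an arc by a quantity that increases
along it.  The inverse is continuous on the whole line, so that its composites
need no domain; the linear continuation of p outside [a, b] makes the
extended p a bijection of the line. *)
Lemma inverse_exists p a b m (p' : R -> R) :
  a < b -> continuity p ->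
  (forall t, a < t < b -> t <> m -> is_derive p t (p' t) /\ 0 < p' t) ->
  p a < p b /\
  exists g, continuity g /\ g (p a) = a /\ g (p b) = b /\
    (forall s, p a <= s <= p b -> a <= g s <= b /\ p (g s) = s) /\
    (forall s, p a < s < p b -> a < g s < b) /\
    (forall s r, p a <= s -> s < r -> r <= p b -> g s < g r) /\
    (forall s, p a < s < p b -> s <> p m -> is_derive g s (/ p' (g s))).
Proof.
intros hab cp dp.
assert (inc : forall s t, a <= s -> s < t -> t <= b -> p s < p t).
{ intros s t h1 h2 h3. apply strict_increase with m; auto.
  intros r hr ne. exists (p' r). apply dp; [lra|exact ne]. }
set (c := clamp a b).
assert (cin : forall t, a <= c t <= b) by (intro t; apply clamp_in; lra).
assert (cid : forall t, a <= t <= b -> c t = t) by (intro t; apply clamp_id).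
assert (clip : forall s t, s <= t -> c s <= c t /\ c t - c s <= t - s).
{ intros s t h. unfold c, clamp, Rmax, Rmin. repeat destruct Rle_dec; lra. }
assert (cc : continuity c) by (apply clamp_continuity; lra).
set (P := fun t => p (c t) + (t - c t)).
assert (cP : continuity P).
{ apply continuity_plus; [apply (continuity_comp c p); auto|].
  apply continuity_minus; [apply derivable_continuous, derivable_id|exact cc]. }
assert (Pp : forall t, a <= t <= b -> P t = p t).
{ intros t ht. unfold P. rewrite cid; [ring|exact ht]. }
assert (Pinc : forall s t, s < t -> P s < P t).
{ intros s t h. unfold P. destruct (clip s t) as [[h1|h1] h2]; [lra| |].
  - assert (p (c s) < p (c t)) by (apply inc; [apply cin|exact h1|apply cin]). lra.
  - rewrite <- h1 in *. lra. }
assert (Psur : forall s, exists t, P t = s).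
{ intro s.
  assert (far : exists u v, u < v /\ P u < s < P v).
  { exists (Rmin a (a - (p a - s) - 1)), (Rmax b (b + (s - p b) + 1)).
    assert (ca : forall t, t <= a -> c t = a) by
      (intros t ht; unfold c, clamp, Rmax, Rmin; repeat destruct Rle_dec; lra).
    assert (cb : forall t, b <= t -> c t = b) by
      (intros t ht; unfold c, clamp, Rmax, Rmin; repeat destruct Rle_dec; lra).
    assert (h1 := Rmin_l a (a - (p a - s) - 1)).
    assert (h2 := Rmin_r a (a - (p a - s) - 1)).
    assert (h3 := Rmax_l b (b + (s - p b) + 1)).
    assert (h4 := Rmax_r b (b + (s - p b) + 1)).
    unfold P. rewrite (ca _ h1), (cb _ h3). lra. }
  destruct far as [u [v [huv [h1 h2]]]].
  destruct (IVT (fun t => P t - s) u v) as [t [_ ht]].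
  - apply continuity_minus; [exact cP|]. apply continuity_const. intros x y; reflexivity.
  - exact huv.
  - lra.
  - lra.
  - exists t. lra. }
set (g := fun s => proj1_sig (constructive_indefinite_description _ (Psur s))).
assert (Pg : forall s, P (g s) = s).
{ intro s. unfold g. apply proj2_sig. }
assert (gP : forall t, g (P t) = t).
{ intro t. destruct (Rtotal_order (g (P t)) t) as [h|[h|h]]; [|exact h|];
  apply Pinc in h; rewrite Pg in h; lra. }
assert (ginc : forall s r, s < r -> g s < g r).
{ intros s r h. destruct (Rlt_or_le (g s) (g r)) as [k|[k|k]]; [exact k| |].
  - apply Pinc in k. rewrite !Pg in k. lra.
  - rewrite <- (Pg s), <- (Pg r), k in h. lra. }
assert (cg : continuity g).
{ intros s eps he.
  assert (h1 : P (g s - eps) < s) by (rewrite <- (Pg s) at 2; apply Pinc; lra).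
  assert (h2 : s < P (g s + eps)) by (rewrite <- (Pg s) at 1; apply Pinc; lra).
  exists (Rmin (s - P (g s - eps)) (P (g s + eps) - s)). split.
  - apply Rmin_glb_lt; lra.
  - intros r [_ hr]. unfold dist in *; simpl in *; unfold R_dist in *.
    assert (k1 := Rmin_l (s - P (g s - eps)) (P (g s + eps) - s)).
    assert (k2 := Rmin_r (s - P (g s - eps)) (P (g s + eps) - s)).
    apply Rabs_def2 in hr.
    assert (g (P (g s - eps)) < g r) by (apply ginc; lra).
    assert (g r < g (P (g s + eps))) by (apply ginc; lra).
    rewrite gP in *. apply Rabs_def1; lra. }
assert (ga : g (p a) = a) by (rewrite <- (Pp a) by lra; apply gP).
assert (gb : g (p b) = b) by (rewrite <- (Pp b) by lra; apply gP).
assert (gr : forall s, p a < s < p b -> a < g s < b).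
{ intros s [h1 h2]. apply ginc in h1. apply ginc in h2. lra. }
assert (gr' : forall s, p a <= s <= p b -> a <= g s <= b).
{ intros s [[h1|<-] [h2|h2]]; [specialize (gr s (conj h1 h2)); lra|subst s; lra|lra|lra]. }
split; [apply inc; lra|].
exists g. do 3 (split; [assumption|]). split.
{ intros s hs. split; [now apply gr'|]. rewrite <- Pp; [apply Pg|now apply gr']. }
split; [exact gr|]. split; [intros s r _ h _; now apply ginc|].
intros s hs ne.
assert (hg := gr s hs).
assert (pg : p (g s) = s) by (rewrite <- Pp by lra; apply Pg).
assert (gm : g s <> m) by (intro e; rewrite e in pg; auto).
destruct (dp (g s) hg gm) as [d pos].
apply is_derive_Reals. apply is_derive_Reals in d.
(* difference quotients of g are inverses of those of p *)
intros eps he.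
assert (lim : forall eps, 0 < eps -> exists del, 0 < del /\ forall h, h <> 0 -> Rabs h < del ->
   Rabs (h / (p (g s + h) - p (g s)) - / p' (g s)) < eps).
{ clear eps he. intros eps he.
  set (l := p' (g s)) in *.
  (* l / 2 keeps the difference quotient of p away from 0 *)
  set (e1 := Rmin (l / 2) (eps * l * l / 4)).
  assert (he1 : 0 < e1).
  { apply Rmin_glb_lt; [lra|]. apply Rmult_lt_0_compat; [|lra].
    apply Rmult_lt_0_compat; [|lra]. apply Rmult_lt_0_compat; lra. }
  assert (k1 := Rmin_l (l / 2) (eps * l * l / 4)).
  assert (k2 := Rmin_r (l / 2) (eps * l * l / 4)). fold e1 in k1, k2.
  destruct (d e1 he1) as [del hdel].
  exists del; split; [apply cond_pos|]. intros h h0 hh.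
  specialize (hdel h h0 hh).
  set (q := (p (g s + h) - p (g s)) / h) in *.
  assert (hq : l / 2 < q) by (apply Rabs_def2 in hdel; lra).
  replace (h / (p (g s + h) - p (g s)) - / l) with ((l - q) * / (q * l)).
  2:{ unfold q. field. repeat split; try lra. intro e0.
      unfold q in hq. rewrite e0 in hq. unfold Rdiv in hq. rewrite Rmult_0_l in hq. lra. }
  assert (ql : l * l / 2 < q * l) by nra.
  assert (l2 : 0 < l * l) by nra.
  rewrite Rabs_mult, Rabs_inv, (Rabs_pos_eq (q * l)) by lra.
  apply Rmult_lt_reg_r with (q * l); [lra|].
  rewrite Rmult_assoc, Rinv_l by lra.
  rewrite Rabs_minus_sym. rewrite Rmult_1_r. apply Rlt_le_trans with (1 := hdel).
  apply Rle_trans with (1 := k2). apply Rle_trans with (eps * (l * l / 2)); [nra|].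
  apply Rmult_le_compat_l; lra. }
destruct (lim eps he) as [del [hdel L]].
destruct (continuity_near g s del cg hdel) as [d1 [hd1 C1]].
assert (hd2 : 0 < Rmin d1 (Rmin (s - p a) (p b - s))).
{ repeat apply Rmin_glb_lt; lra. }
exists (mkposreal _ hd2). intros h h0 hh. simpl in hh.
assert (k1 := Rmin_l d1 (Rmin (s - p a) (p b - s))).
assert (k2 := Rmin_r d1 (Rmin (s - p a) (p b - s))).
assert (k3 := Rmin_l (s - p a) (p b - s)).
assert (k4 := Rmin_r (s - p a) (p b - s)).
assert (hs2 : p a < s + h < p b) by (apply Rabs_def2 in hh; lra).
assert (hgs := gr _ hs2).
assert (C2 : Rabs (g (s + h) - g s) < del) by (apply C1; replace (s + h - s) with h by ring; lra).
assert (n0 : g (s + h) - g s <> 0).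
{ intro e. apply h0. assert (e2 : g (s + h) = g s) by lra.
  apply (f_equal P) in e2. rewrite !Pg in e2. lra. }
specialize (L _ n0 C2).
replace (g s + (g (s + h) - g s)) with (g (s + h)) in L by ring.
rewrite pg in L. rewrite <- (Pp (g (s + h))) in L by lra. rewrite Pg in L.
replace (s + h - s) with h in L by ring. exact L.
Qed.

(** * Solutions, uniqueness and reciprocals *)

Lemma eq01_sym x y : eq01 x y -> eq01 y x.
Proof. intros h t ht. symmetry. apply h, ht. Qed.

Lemma eq01_trans x y z : eq01 x y -> eq01 y z -> eq01 x z.
Proof. intros h1 h2 t ht. rewrite h1 by exact ht. apply h2, ht. Qed.

Lemma is_solution_ext f x y : eq01 x y -> is_solution f y -> is_solution f x.
Proof.
intros e hy t ht eps he. destruct (hy t ht eps he) as [d [hd h]].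
exists d; split; [exact hd|]. intros s hs.
rewrite !e by (apply ht || apply hs). exact (h s hs).
Qed.

(** Constant continuation outside [0,1].  It turns the derivative relative to
[0,1] into continuity on the whole line and a two-sided derivative in the open
interval, which by [solution_intro] loses nothing. *)
Definition freeze (x : R -> R) (t : R) : R := x (clamp 0 1 t).

Lemma freeze_id x t : I01 t -> freeze x t = x t.
Proof. intro h. unfold freeze. rewrite clamp_id; [reflexivity|exact h]. Qed.

Lemma freeze_continuity f x : is_solution f x -> continuity (freeze x).
Proof.
intros hx t eps he.
assert (ht : I01 (clamp 0 1 t)) by (apply clamp_in; lra).
destruct (cont_deriv x _ I01 _ (hx _ ht) eps he) as [d [hd h]].
exists d; split; [exact hd|]. intros s [_ hs].
unfold dist in *; simpl in *; unfold R_dist in *. unfold freeze.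
destruct (Req_dec (clamp 0 1 s) (clamp 0 1 t)) as [e|ne].
- rewrite e, Rminus_diag, Rabs_R0. exact he.
- apply h. split.
  + split; [apply clamp_in; lra|]. intro e. apply ne. symmetry. exact e.
  + apply Rle_lt_trans with (2 := hs). apply clamp_contract. lra.
Qed.

Lemma freeze_derive f x t :
  is_solution f x -> 0 < t < 1 -> is_derive (freeze x) t (f t (freeze x t)).
Proof.
intros hx ht. apply is_derive_Reals. intros eps he.
assert (hI : I01 t) by (split; lra).
destruct (hx t hI eps he) as [d [hd h]].
assert (hp : 0 < Rmin d (Rmin t (1 - t))) by (repeat apply Rmin_glb_lt; lra).
exists (mkposreal _ hp). intros k k0 hk. simpl in hk.
assert (k1 := Rmin_l d (Rmin t (1 - t))). assert (k2 := Rmin_r d (Rmin t (1 - t))).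
assert (k3 := Rmin_l t (1 - t)). assert (k4 := Rmin_r t (1 - t)).
assert (hI2 : I01 (t + k)) by (apply Rabs_def2 in hk; split; lra).
rewrite !freeze_id by assumption.
assert (G := h (t + k)). simpl in G; unfold R_dist in G.
replace (t + k - t) with k in G by ring. apply G.
split; [split; [exact hI2|lra]|lra].
Qed.

(** One-sided derivatives at the end points come for free from the mean value
theorem when the right-hand side is continuous. *)
Lemma solution_intro f x phi :
  continuity x -> continuity phi ->
  (forall t, I01 t -> phi t = f t (x t)) ->
  (forall t, 0 < t < 1 -> is_derive x t (phi t)) -> is_solution f x.
Proof.
intros cx cphi hphi dx t ht eps he.
destruct (continuity_near phi t eps cphi he) as [d [hd h]].
exists d; split; [exact hd|]. intros s [[hs ne] hst].
simpl in *; unfold R_dist in *. rewrite <- hphi by exact ht.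
assert (Q : exists c, Rabs (c - t) < d /\ (x s - x t) / (s - t) = phi c).
{ unfold I01 in *. apply Rabs_def2 in hst.
  destruct (Rtotal_order s t) as [o|[o|o]]; [|congruence|].
  - destruct (mean_value x s t o cx) as [c [l [hc [hl e]]]].
    { intros r hr. exists (phi r). apply dx; lra. }
    assert (l = phi c).
    { apply is_derive_unique in hl. rewrite <- hl. apply is_derive_unique, dx; lra. }
    exists c. split; [apply Rabs_def1; lra|]. rewrite <- H.
    replace (x s - x t) with (l * (s - t)) by lra. field. lra.
  - destruct (mean_value x t s o cx) as [c [l [hc [hl e]]]].
    { intros r hr. exists (phi r). apply dx; lra. }
    assert (l = phi c).
    { apply is_derive_unique in hl. rewrite <- hl. apply is_derive_unique, dx; lra. }
    exists c. split; [apply Rabs_def1; lra|]. rewrite <- H.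
    replace (x s - x t) with (l * (s - t)) by lra. field. lra. }
destruct Q as [c [hc ->]]. apply h, hc.
Qed.

(** With M a bound of |g|, the functions f^2 exp(-2Mt) and f^2 exp(2Mt) are
monotone, which propagates a zero forwards and backwards. *)
Lemma linear_zero f g t1 :
  continuity f -> continuity g ->
  (forall t, 0 < t < 1 -> is_derive f t (g t * f t)) ->
  0 <= t1 <= 1 -> f t1 = 0 -> forall t, 0 <= t <= 1 -> f t = 0.
Proof.
intros cf cg df h1 e1 t ht.
destruct (continuity_bounded g 0 1) as [M hM]; [lra|exact cg|].
assert (W : forall mu, continuity (fun t => f t * f t * exp (mu * t))).
{ intro mu. cont. intro s. apply derivable_continuous_pt, ex_derive_Reals_0.
  auto_derive. exact I. }
assert (dW : forall mu s, 0 < s < 1 ->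
   is_derive (fun t => f t * f t * exp (mu * t)) s
     ((2 * g s + mu) * (f s * f s * exp (mu * s)))).
{ intros mu s hs. eapply derive_eq.
  - apply (derive_mult (fun t => f t * f t) (fun t => exp (mu * t))).
    + apply (derive_mult f f); apply df, hs.
    + apply (derive_comp exp (fun t => mu * t) s (exp (mu * s)) mu); [apply is_derive_exp|].
      auto_derive; auto; ring.
  - ring. }
assert (K : forall s mu, 0 <= f s * f s * exp (mu * s)).
{ intros s mu. assert (0 <= f s * f s) by nra. assert (e := exp_pos (mu * s)). nra. }
assert (Z : forall mu, f t * f t * exp (mu * t) <= 0 -> f t = 0).
{ intros mu h. assert (e := exp_pos (mu * t)). assert (0 <= f t * f t) by nra.
  assert (f t * f t = 0) by nra. nra. }
destruct (Rtotal_order t1 t) as [o|[<-|o]]; [|exact e1|].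
- destruct (mean_value (fun t => f t * f t * exp (- (2 * M) * t)) t1 t o (W _))
    as [c [l [hc [hl e]]]].
  + intros r hr. eexists. apply dW. lra.
  + assert (El := derive_unique _ _ _ _ hl (dW (- (2 * M)) c ltac:(lra))).
    apply (Z (- (2 * M))). rewrite e1 in e.
    assert (B := hM c ltac:(lra)). apply Rabs_le_between in B. specialize (K c (- (2 * M))).
    assert (l <= 0) by (rewrite El; nra). assert (l * (t - t1) <= 0) by nra. lra.
- destruct (mean_value (fun t => f t * f t * exp (2 * M * t)) t t1 o (W _))
    as [c [l [hc [hl e]]]].
  + intros r hr. eexists. apply dW. lra.
  + assert (El := derive_unique _ _ _ _ hl (dW (2 * M) c ltac:(lra))).
    apply (Z (2 * M)). rewrite e1 in e.
    assert (B := hM c ltac:(lra)). apply Rabs_le_between in B. specialize (K c (2 * M)).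
    assert (0 <= l) by (rewrite El; nra). assert (0 <= l * (t1 - t)) by nra. lra.
Qed.

Lemma constant_solution f r : (forall t, f t r = 0) -> is_solution f (fun _ => r).
Proof.
intro h. apply (solution_intro f (fun _ => r) (fun _ => 0)); [cont|cont| |].
- intros t _. rewrite h. reflexivity.
- intros t _. apply derive_const.
Qed.

Definition quad (a0 a1 a2 t : R) : R := a0 + a1 * t + a2 * t ^ 2.

(** This is A B' - A' B for A = [quad a0 a1 a2] and B = [quad b0 b1 b2]; the
terms in t^3 cancel. *)
Definition wronskian (a0 a1 a2 b0 b1 b2 t : R) : R :=
  (a0 * b1 - a1 * b0) + 2 * (a0 * b2 - a2 * b0) * t + (a1 * b2 - a2 * b1) * t ^ 2.

Lemma quad_continuity a0 a1 a2 : continuity (quad a0 a1 a2).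
Proof.
intro t. apply derivable_continuous_pt, ex_derive_Reals_0.
unfold quad. auto_derive. exact I.
Qed.

Lemma abel_quad a0 a1 a2 b0 b1 b2 t x :
  abel a0 a1 a2 b0 b1 b2 t x = quad a0 a1 a2 t * x ^ 3 + quad b0 b1 b2 t * x ^ 2.
Proof. reflexivity. Qed.

(** Uniqueness: the difference of two solutions solves a homogeneous linear
equation. *)
Lemma solutions_disjoint a0 a1 a2 b0 b1 b2 x y :
  is_solution (abel a0 a1 a2 b0 b1 b2) x -> is_solution (abel a0 a1 a2 b0 b1 b2) y ->
  ~ eq01 x y -> forall t, freeze x t <> freeze y t.
Proof.
intros hx hy ne t e. apply ne. intros s hs.
assert (cx := freeze_continuity _ _ hx). assert (cy := freeze_continuity _ _ hy).
assert (cA := quad_continuity a0 a1 a2). assert (cB := quad_continuity b0 b1 b2).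
assert (P : forall n, continuity (fun r => freeze x r ^ n)).
{ intro n. apply (continuity_comp (freeze x) (fun v => v ^ n)); [exact cx|].
  apply derivable_continuous, derivable_pow. }
assert (Z := linear_zero (fun t => freeze x t - freeze y t)
  (fun t => quad a0 a1 a2 t * (freeze x t * freeze x t + freeze x t * freeze y t + freeze y t * freeze y t)
     + quad b0 b1 b2 t * (freeze x t + freeze y t)) (clamp 0 1 t)).
enough (freeze x s - freeze y s = 0) by (rewrite !freeze_id in H by exact hs; lra).
apply Z; [cont|cont| | | |exact hs].
- intros r hr. eapply derive_eq.
  + apply (derive_minus (freeze x) (freeze y)); apply freeze_derive; eassumption.
  + rewrite !abel_quad. ring.
- apply clamp_in; lra.
- assert (hc : I01 (clamp 0 1 t)) by (apply clamp_in; lra).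
  rewrite !freeze_id by exact hc. unfold freeze in e. lra.
Qed.

(** Reciprocals of the nonzero closed solutions of x' = A x^3 + B x^2, continued by
constants so that sign conditions hold on the whole line. *)
Definition closed_recip (A B u : R -> R) : Prop :=
  continuity u /\ (forall t, u t <> 0) /\ u 0 = u 1 /\
  (forall t, t <= 0 -> u t = u 0) /\ (forall t, 1 <= t -> u t = u 1) /\
  forall t, 0 < t < 1 -> is_derive u t (- (A t / u t + B t)).

Lemma closed_solution_recip a0 a1 a2 b0 b1 b2 x :
  closed_solution (abel a0 a1 a2 b0 b1 b2) x -> ~ eq01 x (fun _ => 0) ->
  (forall t, freeze x t <> 0) /\
  closed_recip (quad a0 a1 a2) (quad b0 b1 b2) (fun t => / freeze x t).
Proof.
intros [hx e] ne.
assert (nz : forall t, freeze x t <> 0).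
{ apply (solutions_disjoint a0 a1 a2 b0 b1 b2 x (fun _ => 0) hx); [|exact ne].
  apply constant_solution. intro t. rewrite abel_quad. ring. }
assert (cx := freeze_continuity _ _ hx).
split; [exact nz|].
split; [cont|]. split; [intro t; apply Rinv_neq_0_compat, nz|].
split; [rewrite !freeze_id by (split; lra); rewrite e; reflexivity|].
assert (lo : forall t, t <= 0 -> freeze x t = freeze x 0).
{ intros t h. unfold freeze, clamp. f_equal. unfold Rmax, Rmin. repeat destruct Rle_dec; lra. }
assert (hi : forall t, 1 <= t -> freeze x t = freeze x 1).
{ intros t h. unfold freeze, clamp. f_equal. unfold Rmax, Rmin. repeat destruct Rle_dec; lra. }
split; [intros t h; rewrite lo; auto|].
split; [intros t h; rewrite hi; auto|].
intros t ht. eapply derive_eq.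
- apply is_derive_inv; [apply freeze_derive; eassumption|apply nz].
- rewrite abel_quad. simpl. field. apply nz.
Qed.

Lemma closed_recip_opp a0 a1 a2 b0 b1 b2 u :
  closed_recip (quad a0 a1 a2) (quad b0 b1 b2) u ->
  closed_recip (quad a0 a1 a2) (quad (- b0) (- b1) (- b2)) (fun t => - u t).
Proof.
intros [cu [nu [e [lo [hi du]]]]].
split; [cont|]. split; [|split; [|split; [|split]]].
- intros t h. apply (nu t). lra.
- lra.
- intros t h. rewrite lo; auto.
- intros t h. rewrite hi; auto.
- intros t ht. eapply derive_eq; [exact (is_derive_opp u t _ (du t ht))|].
  unfold opp, quad; simpl. field. apply nu.
Qed.

(** * Combinations of the coefficients of constant sign *)

(** With Y(u) = u + c ln|u - c|, the derivative of Y(u1) - Y(u2) is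
(A + cB) (u1 - u2) / ((u1 - c) (u2 - c)), of constant sign.  For c = 0 this is
the case in which A keeps its sign. *)
Lemma transversal_line A B c k t0 u1 u2 :
  closed_recip A B u1 -> closed_recip A B u2 -> (forall t, u1 t <> u2 t) ->
  (forall t, u1 t <> c) -> (forall t, u2 t <> c) ->
  (forall t, 0 < t < 1 -> t <> t0 -> 0 < k * (A t + c * B t)) -> False.
Proof.
intros [c1 [n1 [e1 [_ [_ d1]]]]] [c2 [n2 [e2 [_ [_ d2]]]]] n12 h1 h2 pos.
assert (g1 : forall t, u1 t - c <> 0) by (intro t; specialize (h1 t); lra).
assert (g2 : forall t, u2 t - c <> 0) by (intro t; specialize (h2 t); lra).
assert (g12 : forall t, u1 t - u2 t <> 0) by (intro t; specialize (n12 t); lra).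
set (s := fun t => (u1 t - u2 t) * ((u1 t - c) * (u2 t - c))).
assert (ss : forall t, 0 < s 0 * s t).
{ intro t. apply constant_sign; [unfold s; cont|]. intro r. unfold s.
  repeat apply Rmult_integral_contrapositive_currified; auto. }
set (f := fun t => k * s 0 * ((u1 t + c * ln (Rabs (u1 t - c))) - (u2 t + c * ln (Rabs (u2 t - c))))).
assert (l1 : continuity (fun t => ln (Rabs (u1 t - c)))).
{ apply (continuity_ln_abs (fun t => u1 t - c)); [cont|exact g1]. }
assert (l2 : continuity (fun t => ln (Rabs (u2 t - c)))).
{ apply (continuity_ln_abs (fun t => u2 t - c)); [cont|exact g2]. }
assert (dl : forall u t l, u t - c <> 0 -> is_derive u t l ->
   is_derive (fun t => u t + c * ln (Rabs (u t - c))) t (l + c * (l / (u t - c)))).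
{ intros u t l h d. apply (derive_plus u (fun t => c * ln (Rabs (u t - c)))); [exact d|].
  eapply derive_eq.
  - apply (derive_mult (fun _ => c) (fun t => ln (Rabs (u t - c)))); [apply derive_const|].
    apply (derive_ln_abs (fun t => u t - c)); [exact h|].
    apply (derive_minus u (fun _ => c)); [exact d|apply derive_const].
  - simpl. field. exact h. }
assert (f 0 < f 1).
{ apply (strict_increase f 0 1 t0); [lra|unfold f; cont|].
  intros t ht ne.
  exists (k * (A t + c * B t) * (s 0 * s t) / ((u1 t - c) * (u2 t - c) * ((u1 t - c) * (u2 t - c)))).
  split.
  - eapply derive_eq.
    + apply (derive_mult (fun _ => k * s 0)); [apply derive_const|].
      apply (derive_minus (fun t => u1 t + c * ln (Rabs (u1 t - c)))
                          (fun t => u2 t + c * ln (Rabs (u2 t - c)))).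
      * apply dl; [apply g1|apply d1, ht].
      * apply dl; [apply g2|apply d2, ht].
    + assert (Hs : s t = (u1 t - u2 t) * ((u1 t - c) * (u2 t - c))) by reflexivity.
      rewrite Hs. simpl. field. auto.
  - apply Rdiv_lt_0_compat; [apply Rmult_lt_0_compat; auto|].
    specialize (g1 t); specialize (g2 t).
    assert ((u1 t - c) * (u2 t - c) <> 0) by (apply Rmult_integral_contrapositive_currified; auto).
    nra. }
unfold f in H. rewrite e1, e2 in H. lra.
Qed.

(** The limit of [transversal_line] as c tends to infinity, with u^2 as the
function that separates the two solutions. *)
Lemma transversal_infinity A B k t0 u1 u2 :
  closed_recip A B u1 -> closed_recip A B u2 -> (forall t, u1 t <> u2 t) ->
  (forall t, 0 < t < 1 -> t <> t0 -> 0 < k * B t) -> False.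
Proof.
intros [c1 [n1 [e1 [_ [_ d1]]]]] [c2 [n2 [e2 [_ [_ d2]]]]] n12 pos.
set (s := fun t => u1 t - u2 t).
assert (ss : forall t, 0 < s 0 * s t).
{ intro t. apply constant_sign; [unfold s; cont|]. intro r. specialize (n12 r). unfold s; lra. }
set (f := fun t => k * s 0 * (u2 t * u2 t - u1 t * u1 t)).
assert (f 0 < f 1).
{ apply (strict_increase f 0 1 t0); [lra|unfold f; cont|].
  intros t ht ne. exists (2 * (k * B t * (s 0 * s t))). split.
  - eapply derive_eq.
    + apply (derive_mult (fun _ => k * s 0)); [apply derive_const|].
      apply (derive_minus (fun t => u2 t * u2 t) (fun t => u1 t * u1 t)).
      * apply (derive_mult u2 u2); apply d2, ht.
      * apply (derive_mult u1 u1); apply d1, ht.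
    + assert (Hs : s t = u1 t - u2 t) by reflexivity.
      rewrite Hs. simpl. field. auto.
  - apply Rmult_lt_0_compat; [lra|]. apply Rmult_lt_0_compat; auto. }
unfold f in H. rewrite e1, e2 in H. lra.
Qed.

(** On the line u = c the slope is -(A + cB)/c, so the line is crossed in one
direction only, and a closed solution cannot return; the barrier lemma also
covers the tangency at t0. *)
Lemma line_not_crossed A B c k t0 u :
  continuity B -> closed_recip A B u ->
  (forall t, 0 < t < 1 -> t <> t0 -> 0 < k * (A t + c * B t)) ->
  forall t, u t <> c.
Proof.
intros cB [cu [nu [e01 [lo [hi du]]]]] pos.
assert (W : forall t, 0 <= t <= 1 -> u t <> c).
{ (* the factors k and u 0 make the inhomogeneous term positive *)
  set (f := fun t => - k * u 0 * (u t - c)).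
  assert (cf : continuity f) by (unfold f; cont).
  destruct (continuity_bounded (fun t => B t / u t) 0 1) as [lam hlam]; [lra|cont|].
  assert (df : forall t, 0 < t < 1 -> t <> t0 ->
    exists e n, is_derive f t (n + e) /\ Rabs e <= lam * Rabs (f t) /\ 0 < n).
  { intros t ht ne. exists (- (B t / u t) * f t), (k * (A t + c * B t) * (u 0 / u t)).
    split; [|split].
    - eapply derive_eq.
      + apply (derive_mult (fun _ => - k * u 0)); [apply derive_const|].
        apply (derive_minus u (fun _ => c)); [apply du, ht|apply derive_const].
      + unfold f. simpl. field. apply nu.
    - rewrite Rabs_mult, Rabs_Ropp. apply Rmult_le_compat_r; [apply Rabs_pos|].
      apply hlam; lra.
    - apply Rmult_lt_0_compat; [apply pos; assumption|].
      replace (u 0 / u t) with (u 0 * u t / (u t * u t)) by (field; apply nu).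
      apply Rdiv_lt_0_compat; [apply constant_sign; assumption|].
      specialize (nu t). nra. }
  assert (f01 : f 0 = f 1) by (unfold f; rewrite <- e01; reflexivity).
  assert (nf : forall t, 0 <= t <= 1 -> f t <> 0).
  { destruct (Rle_or_lt 0 (f 0)) as [h|h].
    - assert (P : forall t, 0 < t <= 1 -> 0 < f t).
      { apply (barrier f 0 1 t0 lam); [exact cf|exact h|].
        intros t ht ne. destruct (df t ht ne) as [e [n [h1 [h2 h3]]]].
        eexists; split; [exact h1|]. apply Rabs_le_between in h2. lra. }
      intros t ht. destruct (Req_dec t 0) as [->|ne].
      + rewrite f01. specialize (P 1 ltac:(lra)). lra.
      + specialize (P t ltac:(lra)). lra.
    - assert (P : forall t, 0 <= t < 1 -> 0 < - f t).
      { apply (barrier_rev (fun t => - f t) 0 1 t0 lam); [cont|lra|].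
        intros t ht ne. destruct (df t ht ne) as [e [n [h1 [h2 h3]]]].
        exists (- (n + e)). split; [exact (is_derive_opp f t _ h1)|].
        rewrite Rabs_Ropp. apply Rabs_le_between in h2. lra. }
      intros t ht. destruct (Req_dec t 1) as [->|ne].
      + rewrite <- f01. specialize (P 0 ltac:(lra)). lra.
      + specialize (P t ltac:(lra)). lra. }
  intros t ht e. apply (nf t ht). unfold f. rewrite e. ring. }
intros t. destruct (Rle_or_lt t 0) as [h|h]; [rewrite lo by exact h; apply W; lra|].
destruct (Rle_or_lt 1 t) as [h'|h']; [rewrite hi by exact h'; apply W; lra|].
apply W; lra.
Qed.

(** The combination has a double root at t0 and, as A and B are not proportional,
does not vanish identically; hence it is a nonzero multiple of
(t - t0)^2. *)
Lemma double_root_combination a0 a1 a2 b0 b1 b2 t0 al be u1 u2 :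
  a0 * b1 - a1 * b0 <> 0 \/ a0 * b2 - a2 * b0 <> 0 \/ a1 * b2 - a2 * b1 <> 0 ->
  al <> 0 \/ be <> 0 ->
  al * quad a0 a1 a2 t0 + be * quad b0 b1 b2 t0 = 0 ->
  al * (a1 + 2 * a2 * t0) + be * (b1 + 2 * b2 * t0) = 0 ->
  closed_recip (quad a0 a1 a2) (quad b0 b1 b2) u1 ->
  closed_recip (quad a0 a1 a2) (quad b0 b1 b2) u2 ->
  (forall t, u1 t <> u2 t) -> False.
Proof.
intros m ab e0 e1 s1 s2 n12.
set (g := al * a2 + be * b2).
assert (C : forall t, al * quad a0 a1 a2 t + be * quad b0 b1 b2 t = g * (t - t0) ^ 2).
{ intro t.
  replace (g * (t - t0) ^ 2) with (al * quad a0 a1 a2 t + be * quad b0 b1 b2 t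
     - (t - t0) * (al * (a1 + 2 * a2 * t0) + be * (b1 + 2 * b2 * t0))
     - (al * quad a0 a1 a2 t0 + be * quad b0 b1 b2 t0)) by (unfold g, quad; ring).
  rewrite e0, e1. ring. }
assert (g0 : g <> 0).
{ intro g0. rewrite g0 in C.
  assert (C0 := C 0). assert (C1 := C 1). unfold g in g0. unfold quad in *.
  assert (i0 : al * a0 + be * b0 = 0) by lra.
  assert (i1 : al * a1 + be * b1 = 0) by lra.
  assert (j : forall x, al * x = 0 -> be * x = 0 -> x = 0).
  { intros x h1 h2. destruct ab as [h|h].
    - apply Rmult_integral in h1. destruct h1; [contradiction|assumption].
    - apply Rmult_integral in h2. destruct h2; [contradiction|assumption]. }
  assert (k : forall ai aj bi bj, al * ai + be * bi = 0 -> al * aj + be * bj = 0 ->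
     ai * bj - aj * bi = 0).
  { intros ai aj bi bj h1 h2. apply j.
    - replace (al * (ai * bj - aj * bi)) with
        ((al * ai + be * bi) * bj - (al * aj + be * bj) * bi) by ring.
      rewrite h1, h2. ring.
    - replace (be * (ai * bj - aj * bi)) with
        (ai * (al * aj + be * bj) - aj * (al * ai + be * bi)) by ring.
      rewrite h1, h2. ring. }
  destruct m as [m|[m|m]]; apply m; apply k; assumption. }
assert (pos : forall t, t <> t0 -> 0 < g * (g * (t - t0) ^ 2)).
{ intros t ne. replace (g * (g * (t - t0) ^ 2)) with ((g * (t - t0)) ^ 2) by ring.
  apply pow2_gt_0. apply Rmult_integral_contrapositive_currified; [exact g0|lra]. }
destruct (Req_dec al 0) as [al0|al0].
- apply (transversal_infinity (quad a0 a1 a2) (quad b0 b1 b2) (g * be) t0 u1 u2); auto.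
  intros t _ ne. specialize (C t). rewrite al0 in C.
  rewrite Rmult_assoc. replace (be * quad b0 b1 b2 t) with (g * (t - t0) ^ 2) by lra. auto.
- assert (L : forall t, 0 < t < 1 -> t <> t0 ->
    0 < g * al * (quad a0 a1 a2 t + be / al * quad b0 b1 b2 t)).
  { intros t _ ne.
    replace (g * al * (quad a0 a1 a2 t + be / al * quad b0 b1 b2 t))
      with (g * (al * quad a0 a1 a2 t + be * quad b0 b1 b2 t)) by (field; exact al0).
    rewrite C. auto. }
  assert (cB := quad_continuity b0 b1 b2).
  apply (transversal_line (quad a0 a1 a2) (quad b0 b1 b2) (be / al) (g * al) t0 u1 u2); auto;
  eapply line_not_crossed; eauto.
Qed.

(** * Three solutions compared on two arcs *)

Lemma ln_lipschitz q r :
  0 < q -> 0 < r -> Rabs (q - r) <= (q + r) * Rabs (ln q - ln r).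
Proof.
assert (W : forall q r, 0 < q -> 0 < r -> r <= q -> q - r <= (q + r) * (ln q - ln r)).
{ intros x y hx hy h.
  assert (e := exp_ineq1_le (ln y - ln x)).
  unfold Rminus in e at 2. rewrite exp_plus, exp_Ropp, !exp_ln in e by assumption.
  assert (x * (1 + (ln y - ln x)) <= y).
  { replace y with (x * (y * / x)) at 2 by (field; lra). apply Rmult_le_compat_l; lra. }
  assert (ln y <= ln x) by (apply ln_le; assumption). nra. }
intros hq hr. destruct (Rle_or_lt r q) as [h|h].
- rewrite !Rabs_pos_eq; [apply W; assumption| |lra].
  assert (ln r <= ln q) by (apply ln_le; assumption). lra.
- rewrite (Rabs_minus_sym q), (Rabs_minus_sym (ln q)), !Rabs_pos_eq.
  + rewrite (Rplus_comm q). apply W; lra.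
  + assert (ln q <= ln r) by (apply ln_le; lra). lra.
  + lra.
Qed.

(** In the parameter s = ln(U2 - U1) the logarithm of the ratio U1/U2 obeys an
equation in which k = B/A enters additively, multiplied by U2 - U1, a function
of s alone; the comparison of two arcs rests on this. *)
Lemma quotient_derive U1 U2 U3 k s :
  0 < U1 s * U2 s -> U1 s < U2 s -> U3 s <> 0 ->
  is_derive U1 s (- U2 s * (1 + k * U1 s)) ->
  is_derive U2 s (- U1 s * (1 + k * U2 s)) ->
  is_derive U3 s (- (U1 s * U2 s / U3 s) * (1 + k * U3 s)) ->
  is_derive (fun s => ln (Rabs (U1 s / U2 s))) s
    (U1 s / U2 s - U2 s / U1 s - k * (U2 s - U1 s)) /\
  is_derive (fun s => (U3 s - U2 s) / (U2 s - U1 s)) s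
    ((U3 s - U2 s) / (U2 s - U1 s) * (U1 s / U3 s - 1)).
Proof.
intros h12 h21 h3 d1 d2 d3.
assert (n1 : U1 s <> 0) by (intro e; rewrite e in h12; lra).
assert (n2 : U2 s <> 0) by (intro e; rewrite e in h12; lra).
split.
- eapply derive_eq.
  + apply (derive_ln_abs (fun s => U1 s / U2 s)).
    * unfold Rdiv. apply Rmult_integral_contrapositive_currified; [exact n1|].
      apply Rinv_neq_0_compat, n2.
    * apply (is_derive_div U1 U2); [exact d1|exact d2|exact n2].
  + simpl. field. split; assumption.
- eapply derive_eq.
  + apply (is_derive_div (fun s => U3 s - U2 s) (fun s => U2 s - U1 s));
      [apply (derive_minus U3 U2); [exact d3|exact d2]|apply (derive_minus U2 U1); [exact d2|exact d1]|lra].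
  + simpl. field. split; (assumption || lra).
Qed.

(** The functions U and V are the same three solutions along the arc where
ln(u2 - u1) increases and along the arc where it decreases, both parametrized by
that quantity; k and l are the values of B/A.  As k - l increases, it is first
negative and then positive, or keeps one sign; this makes D, the difference of
ln(u1/u2) between the arcs, positive: where k - l <= 0 by comparison from the left
end, where k - l > 0 by comparison from the right end.  Then E, the difference of
(u3 - u2)/(u2 - u1), has a drift of constant sign and cannot vanish at both
ends. *)
Lemma three_solution_core s0 s1 m sg U1 U2 U3 V1 V2 V3 k l :
  s0 < s1 ->
  continuity U1 -> continuity U2 -> continuity U3 ->
  continuity V1 -> continuity V2 -> continuity V3 ->
  (forall s, 0 < U1 s * U2 s) -> (forall s, 0 < V1 s * V2 s) ->
  (forall s, U1 s < U2 s) -> (forall s, V1 s < V2 s) ->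
  (forall s, 0 < (U2 s * V2 s) * (U3 s * V3 s)) ->
  (forall s, 0 < sg * ((U3 s - U1 s) * (U3 s - U2 s))) ->
  (forall s, s0 <= s <= s1 -> U2 s - U1 s = V2 s - V1 s) ->
  U1 s0 = V1 s0 -> U2 s0 = V2 s0 -> U3 s0 = V3 s0 ->
  U1 s1 = V1 s1 -> U2 s1 = V2 s1 -> U3 s1 = V3 s1 ->
  (forall s r, s0 < s -> s < r -> r < s1 -> k s - l s < k r - l r) ->
  (forall s, s0 < s < s1 -> s <> m ->
     is_derive U1 s (- U2 s * (1 + k s * U1 s)) /\
     is_derive U2 s (- U1 s * (1 + k s * U2 s)) /\
     is_derive U3 s (- (U1 s * U2 s / U3 s) * (1 + k s * U3 s))) ->
  (forall s, s0 < s < s1 -> s <> m ->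
     is_derive V1 s (- V2 s * (1 + l s * V1 s)) /\
     is_derive V2 s (- V1 s * (1 + l s * V2 s)) /\
     is_derive V3 s (- (V1 s * V2 s / V3 s) * (1 + l s * V3 s))) ->
  False.
Proof.
intros h01 cU1 cU2 cU3 cV1 cV2 cV3 pU pV oU oV p23 sgU gap e10 e20 e30 e11 e21 e31 K dU dV.
assert (nU1 : forall s, U1 s <> 0) by (intros s e; specialize (pU s); rewrite e in pU; lra).
assert (nU2 : forall s, U2 s <> 0) by (intros s e; specialize (pU s); rewrite e in pU; lra).
assert (nV1 : forall s, V1 s <> 0) by (intros s e; specialize (pV s); rewrite e in pV; lra).
assert (nV2 : forall s, V2 s <> 0) by (intros s e; specialize (pV s); rewrite e in pV; lra).
assert (nU3 : forall s, U3 s <> 0) by (intros s e; specialize (p23 s); rewrite e in p23; lra).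
assert (nV3 : forall s, V3 s <> 0) by (intros s e; specialize (p23 s); rewrite e in p23; lra).
assert (ndU : forall s, U2 s - U1 s <> 0) by (intro s; specialize (oU s); lra).
assert (ndV : forall s, V2 s - V1 s <> 0) by (intro s; specialize (oV s); lra).
set (q := fun s => U1 s / U2 s). set (r := fun s => V1 s / V2 s).
assert (quot_pos : forall x y, 0 < x * y -> 0 < x / y).
{ intros x y h. replace (x / y) with (x * y * / (y * y)).
  - apply Rmult_lt_0_compat; [exact h|]. apply Rinv_0_lt_compat. nra.
  - field. intros ->. lra. }
assert (qpos : forall s, 0 < q s) by (intro s; apply quot_pos, pU).
assert (rpos : forall s, 0 < r s) by (intro s; apply quot_pos, pV).
assert (cq : continuity q) by (unfold q; cont).
assert (cr : continuity r) by (unfold r; cont).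
assert (nq : forall s, q s <> 0) by (intros s; specialize (qpos s); lra).
assert (nr : forall s, r s <> 0) by (intros s; specialize (rpos s); lra).
set (D := fun s => ln (Rabs (q s)) - ln (Rabs (r s))).
assert (cD : continuity D).
{ apply continuity_minus; apply continuity_ln_abs; assumption. }
assert (D0 : D s0 = 0) by (unfold D, q, r; rewrite e10, e20; ring).
assert (D1 : D s1 = 0) by (unfold D, q, r; rewrite e11, e21; ring).
destruct (continuity_bounded (fun s => (q s + r s) * (1 + / (q s * r s))) s0 s1)
  as [lam hlam]; [lra|cont; intro s; specialize (qpos s); specialize (rpos s); nra|].
assert (dD : forall s, s0 < s < s1 -> s <> m -> exists e,
   is_derive D s (e - (U2 s - U1 s) * (k s - l s)) /\ Rabs e <= lam * Rabs (D s)).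
{ intros s hs ne. exists ((q s - r s) * (1 + / (q s * r s))). split.
  - destruct (dU s hs ne) as [a1 [a2 a3]]. destruct (dV s hs ne) as [b1 [b2 b3]].
    eapply derive_eq.
    + apply (derive_minus (fun s => ln (Rabs (q s))) (fun s => ln (Rabs (r s)))).
      * exact (proj1 (quotient_derive U1 U2 U3 (k s) s (pU s) (oU s) (nU3 s) a1 a2 a3)).
      * exact (proj1 (quotient_derive V1 V2 V3 (l s) s (pV s) (oV s) (nV3 s) b1 b2 b3)).
    + rewrite <- (gap s) by lra. unfold q, r. simpl. field. auto.
  - assert (B := hlam s ltac:(lra)). rewrite Rabs_mult.
    assert (i : 0 < / (q s * r s)) by (apply Rinv_0_lt_compat, Rmult_lt_0_compat; auto).
    rewrite (Rabs_pos_eq (1 + _)) by lra.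
    rewrite Rabs_pos_eq in B.
    2:{ specialize (qpos s); specialize (rpos s). apply Rmult_le_pos; lra. }
    assert (L := ln_lipschitz (q s) (r s) (qpos s) (rpos s)).
    assert (ED : D s = ln (q s) - ln (r s)).
    { unfold D. rewrite !Rabs_pos_eq by (apply Rlt_le; auto). reflexivity. }
    rewrite <- ED in L.
    apply Rle_trans with ((q s + r s) * (1 + / (q s * r s)) * Rabs (D s)).
    + replace ((q s + r s) * (1 + / (q s * r s)) * Rabs (D s))
        with ((q s + r s) * Rabs (D s) * (1 + / (q s * r s))) by ring.
      apply Rmult_le_compat_r; lra.
    + apply Rmult_le_compat_r; [apply Rabs_pos|exact B]. }
assert (Dpos : forall s, s0 < s < s1 -> 0 < D s).
{ intros s hs. destruct (Rle_or_lt (k s - l s) 0) as [h|h].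
  - apply (barrier D s0 s m lam); [exact cD|lra| |lra].
    intros t ht ne. destruct (dD t ltac:(lra) ne) as [e [he1 he2]].
    eexists; split; [exact he1|].
    assert (k t - l t < k s - l s) by (apply K; lra).
    specialize (oU t). apply Rabs_le_between in he2. nra.
  - apply (barrier_rev D s s1 m lam); [exact cD|lra| |lra].
    intros t ht ne. destruct (dD t ltac:(lra) ne) as [e [he1 he2]].
    eexists; split; [exact he1|].
    assert (k s - l s < k t - l t) by (apply K; lra).
    specialize (oU t). apply Rabs_le_between in he2. nra. }
assert (qr : forall s, s0 < s < s1 -> r s < q s).
{ intros s hs. specialize (Dpos s hs). unfold D in Dpos.
  rewrite !Rabs_pos_eq in Dpos by (apply Rlt_le; auto).
  apply ln_lt_inv; auto. lra. }
(* u1/u3 = q / (1 + (1 - q) z), so the equation of z involves only q and z *)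
set (z := fun s => (U3 s - U2 s) / (U2 s - U1 s)).
set (y := fun s => (V3 s - V2 s) / (V2 s - V1 s)).
assert (cz : continuity z) by (unfold z; cont).
assert (cy : continuity y) by (unfold y; cont).
set (w := fun s => (U2 s * V2 s) / (U3 s * V3 s)).
assert (cw : continuity w).
{ unfold w; cont. intros s. apply Rmult_integral_contrapositive_currified; auto. }
assert (wpos : forall s, 0 < w s) by (intro s; apply quot_pos, p23).
set (Lam := fun s => V1 s / V3 s - 1 - z s * q s * (1 - r s) * w s).
assert (cL : continuity Lam) by (unfold Lam; cont).
destruct (continuity_bounded Lam s0 s1) as [mu hmu]; [lra|exact cL|].
set (E := fun s => sg * (z s - y s)).
assert (E1 : 0 < E s1).
{ apply (barrier E s0 s1 m mu).
  - unfold E; cont.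
  - unfold E, z, y. rewrite e10, e20, e30. lra.
  - intros s hs ne.
    exists (sg * (z s * (1 + z s)) * (q s - r s) * w s + Lam s * E s). split.
    + destruct (dU s hs ne) as [a1 [a2 a3]]. destruct (dV s hs ne) as [b1 [b2 b3]].
      eapply derive_eq.
      * apply (derive_mult (fun _ => sg) (fun s => z s - y s));
           [apply derive_const|apply (derive_minus z y)].
        -- exact (proj2 (quotient_derive U1 U2 U3 (k s) s (pU s) (oU s) (nU3 s) a1 a2 a3)).
        -- exact (proj2 (quotient_derive V1 V2 V3 (l s) s (pV s) (oV s) (nV3 s) b1 b2 b3)).
      * unfold E, Lam, w, z, y, q, r. simpl. field. repeat split; auto.
    + assert (B := hmu s ltac:(lra)).
      assert (0 < sg * (z s * (1 + z s))).
      { replace (sg * (z s * (1 + z s)))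
          with (sg * ((U3 s - U1 s) * (U3 s - U2 s)) * / ((U2 s - U1 s) * (U2 s - U1 s)))
          by (unfold z; field; auto).
        apply Rmult_lt_0_compat; [apply sgU|]. apply Rinv_0_lt_compat. specialize (oU s). nra. }
      assert (0 < sg * (z s * (1 + z s)) * (q s - r s) * w s).
      { apply Rmult_lt_0_compat; [apply Rmult_lt_0_compat|apply wpos]; [assumption|].
        specialize (qr s hs). lra. }
      assert (Rabs (Lam s * E s) <= mu * Rabs (E s)).
      { rewrite Rabs_mult. apply Rmult_le_compat_r; [apply Rabs_pos|exact B]. }
      apply Rabs_le_between in H1. lra.
  - lra. }
unfold E, z, y in E1. rewrite e11, e21, e31 in E1. lra.
Qed.

(** The arc [a, b], where ln(u2 - u1) increases, and the arc [c, d], where it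
decreases, have matching ends: a with d and b with c.  The derivatives may
fail to exist at m. *)
Lemma three_solution_arcs a b c d m A B u1 u2 u3 :
  a < b -> c < d ->
  continuity u1 -> continuity u2 -> continuity u3 ->
  (forall t, u1 t <> 0) -> (forall t, u2 t <> 0) -> (forall t, u3 t <> 0) ->
  (forall t, 0 < u1 t * u2 t) -> (forall t, u1 t < u2 t) ->
  (forall t, u3 t <> u1 t) -> (forall t, u3 t <> u2 t) ->
  (u1 a = u1 d /\ u2 a = u2 d /\ u3 a = u3 d) ->
  (u1 b = u1 c /\ u2 b = u2 c /\ u3 b = u3 c) ->
  (forall t, (a < t < b \/ c < t < d) -> t <> m ->
     is_derive u1 t (- (A t / u1 t + B t)) /\
     is_derive u2 t (- (A t / u2 t + B t)) /\
     is_derive u3 t (- (A t / u3 t + B t))) ->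
  (forall t, a < t < b -> t <> m -> 0 < A t) ->
  (forall t, c < t < d -> t <> m -> A t < 0) ->
  (forall s t, a < s -> s < t -> t < b -> B s / A s < B t / A t) ->
  (forall s t, c < s -> s < t -> t < d -> B s / A s < B t / A t) ->
  False.
Proof.
intros hab hcd c1 c2 c3 n1 n2 n3 p12 o12 n31 n32 [ad1 [ad2 ad3]] [bc1 [bc2 bc3]]
  du pA nA kab kcd.
set (p := fun t => ln (Rabs (u2 t - u1 t))).
assert (nd : forall t, u2 t - u1 t <> 0) by (intro t; specialize (o12 t); lra).
assert (cp : continuity p) by (apply (continuity_ln_abs (fun t => u2 t - u1 t)); cont; assumption).
assert (dp : forall t, (a < t < b \/ c < t < d) -> t <> m -> is_derive p t (A t / (u1 t * u2 t))).
{ intros t ht ne. destruct (du t ht ne) as [d1 [d2 _]].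
  eapply derive_eq.
  - apply (derive_ln_abs (fun t => u2 t - u1 t)); [apply nd|].
    apply (derive_minus u2 u1); [exact d2|exact d1].
  - simpl. field. auto. }
destruct (inverse_exists p a b m (fun t => A t / (u1 t * u2 t)))
  as [hp [g [cg [ga [gb [gin [gin' [ginc dg]]]]]]]]; [exact hab|exact cp| |].
{ intros t ht ne. split; [apply dp; auto|]. apply Rdiv_lt_0_compat; auto. }
(* the falling arc is inverted after reversing time *)
destruct (inverse_exists (fun t => p (- t)) (- d) (- c) (- m)
   (fun t => - (A (- t) / (u1 (- t) * u2 (- t)))))
  as [hp' [h [ch [ha [hb [hin [hin' [hinc dh]]]]]]]]; [lra| | |].
{ apply (continuity_comp (fun t => - t) p); [|exact cp].
  apply continuity_opp, derivable_continuous, derivable_id. }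
{ intros t ht ne. split.
  - apply (derive_eq _ _ (A (- t) / (u1 (- t) * u2 (- t)) * -1)); [|ring].
    apply (derive_comp p (fun t => - t)); [|auto_derive; auto].
    apply dp; [right; lra|lra].
  - assert (A (- t) < 0) by (apply nA; lra).
    replace (- (A (- t) / (u1 (- t) * u2 (- t)))) with (- A (- t) / (u1 (- t) * u2 (- t)))
      by (field; auto).
    apply Rdiv_lt_0_compat; [lra|auto]. }
rewrite !Ropp_involutive in *.
assert (pad : p a = p d) by (unfold p; rewrite ad1, ad2; reflexivity).
assert (pbc : p b = p c) by (unfold p; rewrite bc1, bc2; reflexivity).
rewrite <- pad, <- pbc in *. clear hp'.
assert (ck : continuity (fun s => - h s)) by (apply continuity_opp; exact ch).
assert (compc : forall u v, continuity u -> continuity v -> continuity (fun s => u (v s))).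
{ intros u v hu hv. exact (continuity_comp v u hv hu). }
(* the gap between the first two solutions is a function of the parameter *)
assert (pgap : forall t t', p t = p t' -> u2 t - u1 t = u2 t' - u1 t').
{ unfold p. intros t t' e. rewrite !Rabs_pos_eq in e.
  - apply ln_inv in e; [exact e| |]; [specialize (o12 t)|specialize (o12 t')]; lra.
  - specialize (o12 t'); lra.
  - specialize (o12 t); lra. }
assert (sgex : exists sg, forall t, 0 < sg * ((u3 t - u1 t) * (u3 t - u2 t))).
{ exists ((u3 a - u1 a) * (u3 a - u2 a)). intro t.
  apply (constant_sign (fun t => (u3 t - u1 t) * (u3 t - u2 t))); [cont|].
  intros r. specialize (n31 r); specialize (n32 r).
  apply Rmult_integral_contrapositive_currified; lra. }
destruct sgex as [sg hsg].
apply (three_solution_core (p a) (p b) (p m) sg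
  (fun s => u1 (g s)) (fun s => u2 (g s)) (fun s => u3 (g s))
  (fun s => u1 (- h s)) (fun s => u2 (- h s)) (fun s => u3 (- h s))
  (fun s => B (g s) / A (g s)) (fun s => B (- h s) / A (- h s))); auto.
- intro s.
  replace (u2 (g s) * u2 (- h s) * (u3 (g s) * u3 (- h s)))
    with ((u2 (g s) * u3 (g s)) * (u2 (- h s) * u3 (- h s))) by ring.
  apply (constant_sign (fun t => u2 t * u3 t)); [cont|].
  intro r. apply Rmult_integral_contrapositive_currified; auto.
- intros s hs. apply pgap.
  rewrite (proj2 (gin s hs)), (proj2 (hin s hs)). reflexivity.
- rewrite ga, ha, Ropp_involutive. exact ad1.
- rewrite ga, ha, Ropp_involutive. exact ad2.
- rewrite ga, ha, Ropp_involutive. exact ad3.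
- rewrite gb, hb, Ropp_involutive. exact bc1.
- rewrite gb, hb, Ropp_involutive. exact bc2.
- rewrite gb, hb, Ropp_involutive. exact bc3.
- intros s r h1 h2 h3.
  assert (g s < g r) by (apply ginc; lra). assert (h s < h r) by (apply hinc; lra).
  assert (gs := gin' s ltac:(lra)). assert (gr := gin' r ltac:(lra)).
  assert (hs := hin' s ltac:(lra)). assert (hr := hin' r ltac:(lra)).
  assert (B (g s) / A (g s) < B (g r) / A (g r)) by (apply kab; lra).
  assert (B (- h r) / A (- h r) < B (- h s) / A (- h s)) by (apply kcd; lra).
  lra.
- intros s hs ne.
  assert (gs := gin' s hs).
  assert (gm : g s <> m).
  { intro e. apply ne. rewrite <- e. symmetry. apply gin; lra. }
  assert (dgs := dg s hs ne).
  assert (A0 := pA (g s) gs gm).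
  destruct (du (g s) (or_introl gs) gm) as [d1 [d2 d3]].
  split; [|split]; eapply derive_eq.
  + exact (derive_comp u1 g s _ _ d1 dgs).
  + simpl; field; repeat split; auto; lra.
  + exact (derive_comp u2 g s _ _ d2 dgs).
  + simpl; field; repeat split; auto; lra.
  + exact (derive_comp u3 g s _ _ d3 dgs).
  + simpl; field; repeat split; auto; lra.
- intros s hs ne.
  assert (hhs := hin' s hs).
  assert (hcd' : c < - h s < d) by lra.
  assert (hm : - h s <> m).
  { intro e. apply ne. rewrite <- e. symmetry. apply hin; lra. }
  assert (dhs := dh s hs ne).
  assert (A0 := nA (- h s) hcd' hm).
  destruct (du (- h s) (or_intror hcd') hm) as [d1 [d2 d3]].
  assert (dnh' := is_derive_opp h s _ dhs).
  unfold opp in dnh'; simpl in dnh'.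
  split; [|split]; eapply derive_eq.
  + exact (derive_comp u1 _ s _ _ d1 dnh').
  + simpl; field; repeat split; auto; lra.
  + exact (derive_comp u2 _ s _ _ d2 dnh').
  + simpl; field; repeat split; auto; lra.
  + exact (derive_comp u3 _ s _ _ d3 dnh').
  + simpl; field; repeat split; auto; lra.
Qed.

(** * Quadratic coefficients with a positive wronskian *)

(** Two consecutive periods, so that an arc containing the cut 0 = 1 becomes an
interval around 1. *)
Definition wrap (u : R -> R) (t : R) : R := if Rle_dec t 1 then u t else u (t - 1).

Lemma wrap_low u t : t <= 1 -> wrap u t = u t.
Proof. unfold wrap. destruct Rle_dec; [reflexivity|lra]. Qed.

Lemma wrap_high u t : 1 < t -> wrap u t = u (t - 1).
Proof. unfold wrap. destruct Rle_dec; [lra|reflexivity]. Qed.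

Lemma wrap_continuity u :
  continuity u -> u 0 = u 1 -> (forall t, t <= 0 -> u t = u 0) ->
  (forall t, 1 <= t -> u t = u 1) -> continuity (wrap u).
Proof.
intros cu e lo hi.
assert (E : forall t, u t + u (t - 1) - u 0 = wrap u t).
{ intro t. destruct (Rle_or_lt t 1) as [h|h].
  - rewrite wrap_low, (lo (t - 1)) by lra. ring.
  - rewrite wrap_high, (hi t) by lra. rewrite e. ring. }
intro t. apply (continuity_pt_ext (fun t => u t + u (t - 1) - u 0)); [exact E|].
apply continuity_minus; [apply continuity_plus|]; [exact cu| |cont].
apply (continuity_comp (fun t => t - 1) u); [|exact cu].
apply continuity_minus; [apply derivable_continuous, derivable_id|cont].
Qed.

Lemma wrap_derive (u f : R -> R) (t : R) :
  (forall t, 0 < t < 1 -> is_derive u t (f t)) -> 0 < t < 2 -> t <> 1 ->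
  is_derive (wrap u) t (wrap f t).
Proof.
intros du ht ne. destruct (Rle_or_lt t 1) as [h|h].
- rewrite wrap_low by lra.
  apply (is_derive_ext_loc u); [|apply du; lra].
  assert (hd : 0 < 1 - t) by lra. exists (mkposreal _ hd). intros s hs.
  apply Rabs_def2 in hs. unfold minus, plus, opp in hs; simpl in hs.
  rewrite wrap_low by lra. reflexivity.
- rewrite wrap_high by lra.
  apply (is_derive_ext_loc (fun s => u (s - 1))).
  + assert (hd : 0 < t - 1) by lra. exists (mkposreal _ hd). intros s hs.
    apply Rabs_def2 in hs. unfold minus, plus, opp in hs; simpl in hs.
    rewrite wrap_high by lra. reflexivity.
  + apply (derive_eq _ _ (f (t - 1) * 1)); [|ring].
    apply (derive_comp u (fun s => s - 1)); [apply du; lra|].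
    auto_derive; auto; ring.
Qed.

(** The derivative of B/A is the wronskian divided by A^2. *)
Lemma ratio_increasing a0 a1 a2 b0 b1 b2 s t :
  (forall r, 0 < wronskian a0 a1 a2 b0 b1 b2 r) -> s < t ->
  (forall r, s <= r <= t -> quad a0 a1 a2 r <> 0) ->
  quad b0 b1 b2 s / quad a0 a1 a2 s < quad b0 b1 b2 t / quad a0 a1 a2 t.
Proof.
intros V hst nz.
destruct (MVT_cor2 (fun r => quad b0 b1 b2 r / quad a0 a1 a2 r)
  (fun r => wronskian a0 a1 a2 b0 b1 b2 r / (quad a0 a1 a2 r) ^ 2) s t hst) as [c [e hc]].
- intros r hr. apply is_derive_Reals. specialize (nz r hr).
  unfold quad in *. auto_derive; [exact nz|]. unfold wronskian. field. exact nz.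
- assert (0 < wronskian a0 a1 a2 b0 b1 b2 c / quad a0 a1 a2 c ^ 2).
  { apply Rdiv_lt_0_compat; [apply V|]. apply pow2_gt_0, nz; lra. }
  assert (0 < wronskian a0 a1 a2 b0 b1 b2 c / quad a0 a1 a2 c ^ 2 * (t - s)).
  { apply Rmult_lt_0_compat; lra. }
  lra.
Qed.

Lemma linear_sign e f :
  (forall t, 0 < t < 1 -> e + f * t <> 0) ->
  (forall t, 0 < t < 1 -> 0 < e + f * t) \/ (forall t, 0 < t < 1 -> e + f * t < 0).
Proof.
intros nz.
assert (ends : 0 <= e * (e + f)).
{ destruct (Rle_or_lt 0 (e * (e + f))) as [h|h]; [exact h|exfalso].
  assert (f <> 0) by (intros ->; nra).
  apply (nz (- e / f)); [|field; assumption].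
  assert (E : f * (- e / f) = - e) by (field; assumption).
  set (r := - e / f) in *. assert (0 < f * f) by nra.
  assert (E2 : f * f * r = - e * f) by (rewrite Rmult_assoc, E; ring).
  assert (0 <= e * e) by nra. assert (0 <= (e + f) * (e + f)) by nra.
  assert (0 < f * f * r) by lra. assert (0 < f * f * (1 - r)) by lra.
  split; nra. }
assert (hz := nz (1 / 2) ltac:(lra)).
destruct (Rlt_or_le 0 (e + f * (1 / 2))) as [h|h]; [left|right]; intros t ht;
  assert (0 < t * (1 - t)) by nra.
- assert (0 <= e) by nra. assert (0 <= e + f) by nra. nra.
- assert (e <= 0) by nra. assert (e + f <= 0) by nra. nra.
Qed.

(** The direction of the vector (A, B) turns monotonically and makes one full turn
over the real line, as A and B have degree 2; so along the complement of [x, y],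
traversed through infinity, B/A is increasing, and 0 comes after 1 there.  The
computation writes the difference as a combination of the wronskian at x and at y
with positive coefficients. *)
Lemma ratio_across_cut a0 a1 a2 b0 b1 b2 x y :
  (forall r, 0 < wronskian a0 a1 a2 b0 b1 b2 r) ->
  0 < x -> x < y -> y < 1 -> quad a0 a1 a2 x = 0 -> quad a0 a1 a2 y = 0 ->
  quad b0 b1 b2 1 / quad a0 a1 a2 1 < quad b0 b1 b2 0 / quad a0 a1 a2 0.
Proof.
intros V h0 hxy h1 ex ey. assert (Vx := V x). assert (Vy := V y).
unfold quad, wronskian in *.
assert (e1 : a1 = - a2 * (x + y)).
{ assert ((y - x) * (a1 + a2 * (x + y)) = 0) by lra.
  apply Rmult_integral in H. destruct H; lra. }
assert (e0 : a0 = a2 * x * y) by (rewrite e1 in ex; lra).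
subst a0 a1.
assert (n2 : a2 <> 0) by (intros ->; lra).
set (F1 := - (a2 * (- (x + y) * b2 - b1) * x + a2 * (x * y * b2 - b0))).
set (F2 := a2 * (- (x + y) * b2 - b1) * y + a2 * (x * y * b2 - b0)).
assert (P1 : 0 < F1).
{ apply Rmult_lt_reg_l with (y - x); [lra|]. rewrite Rmult_0_r.
  unfold F1. lra. }
assert (P2 : 0 < F2).
{ apply Rmult_lt_reg_l with (y - x); [lra|]. unfold F2. lra. }
assert (pos : 0 < (F1 * (y * (1 - y)) + F2 * (x * (1 - x)))
   / ((y - x) * ((a2 * a2) * ((x * y) * ((1 - x) * (1 - y)))))).
{ apply Rdiv_lt_0_compat.
  - apply Rplus_lt_0_compat; apply Rmult_lt_0_compat; nra.
  - apply Rmult_lt_0_compat; [lra|]. apply Rmult_lt_0_compat; [nra|].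
    repeat apply Rmult_lt_0_compat; lra. }
replace (a2 * x * y + - a2 * (x + y) * 1 + a2 * 1 ^ 2) with (a2 * ((1 - x) * (1 - y))) by ring.
replace (a2 * x * y + - a2 * (x + y) * 0 + a2 * 0 ^ 2) with (a2 * (x * y)) by ring.
apply Rlt_0_minus. eapply Rlt_le_trans; [exact pos|]. right.
unfold F1, F2. field. repeat split; (assumption || lra).
Qed.

(** The arcs are cut out by the zeros of A.  With a single zero x they are [0, x] and
[x, 1]; with two zeros x < y they are [x, y] and [y, 1 + x] in the doubled
period. *)
Lemma no_three_ordered a0 a1 a2 b0 b1 b2 u1 u2 u3 :
  (forall r, 0 < wronskian a0 a1 a2 b0 b1 b2 r) ->
  closed_recip (quad a0 a1 a2) (quad b0 b1 b2) u1 ->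
  closed_recip (quad a0 a1 a2) (quad b0 b1 b2) u2 ->
  closed_recip (quad a0 a1 a2) (quad b0 b1 b2) u3 ->
  (forall t, 0 < u1 t * u2 t) -> (forall t, u1 t < u2 t) ->
  (forall t, u3 t <> u1 t) -> (forall t, u3 t <> u2 t) -> False.
Proof.
intros V s1 s2 s3 p12 o12 n31 n32.
set (A := quad a0 a1 a2) in *. set (B := quad b0 b1 b2) in *.
assert (inc : forall s t, s < t -> (forall r, s <= r <= t -> A r <> 0) -> B s / A s < B t / A t).
{ intros s t h nz. apply ratio_increasing; assumption. }
assert (W1 := s1). assert (W2 := s2). assert (W3 := s3).
destruct W1 as [c1 [n1 [e1 [lo1 [hi1 d1]]]]].
destruct W2 as [c2 [n2 [e2 [lo2 [hi2 d2]]]]].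
destruct W3 as [c3 [n3 [e3 [lo3 [hi3 d3]]]]].
destruct (classic (exists x, 0 < x < 1 /\ A x = 0)) as [[x [hx ex]]|none].
2:{ (* here ln(u2 - u1) is monotone *)
  assert (h2 : A (1 / 2) <> 0) by (intro e; apply none; exists (1 / 2); split; [lra|exact e]).
  apply (transversal_line A B 0 (A (1 / 2)) 2 u1 u2); auto.
  - intros t e. specialize (o12 t). lra.
  - intros t ht _. rewrite Rmult_0_l, Rplus_0_r.
    destruct (Rlt_or_le 0 (A (1 / 2) * A t)) as [h|h]; [exact h|exfalso].
    assert (cA : continuity A) by apply quad_continuity.
    destruct (Rle_or_lt t (1 / 2)) as [k|k].
    + destruct (IVT_cor A t (1 / 2) cA k ltac:(lra)) as [z [hz ez]].
      apply none. exists z. split; [lra|exact ez].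
    + destruct (IVT_cor A (1 / 2) t cA ltac:(lra) h) as [z [hz ez]].
      apply none. exists z. split; [lra|exact ez]. }
set (L := fun t => (a1 + a2 * x) + a2 * t).
assert (fac : forall t, A t = (t - x) * L t).
{ intro t. rewrite <- (Rminus_0_r (A t)), <- ex. unfold A, quad, L. ring. }
destruct (classic (exists y, 0 < y < 1 /\ L y = 0)) as [[y [hy ey]]|none].
- assert (facy : forall t, A t = a2 * ((t - x) * (t - y))).
  { intro t. rewrite fac, <- (Rminus_0_r (L t)), <- ey. unfold L. ring. }
  assert (two : exists x y, 0 < x /\ x < y /\ y < 1 /\ forall t, A t = a2 * ((t - x) * (t - y))).
  { (* a double root of A would be a root of the wronskian *)
    destruct (Rtotal_order x y) as [h|[h|h]].
    - exists x, y. repeat split; try lra. exact facy.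
    - exfalso. subst y. assert (Vx := V x). unfold L in ey.
      unfold A, quad in ex. unfold wronskian in Vx.
      assert (a1 = - 2 * a2 * x) by lra. subst a1. assert (a0 = a2 * x ^ 2) by lra. subst a0.
      lra.
    - exists y, x. repeat split; try lra. intro t. rewrite facy. ring. }
  clear x y hx ex L fac hy ey facy.
  destruct two as [x [y [h0 [hxy [h1 fac]]]]].
  assert (ex : A x = 0) by (rewrite fac; ring).
  assert (ey : A y = 0) by (rewrite fac; ring).
  assert (cut := ratio_across_cut a0 a1 a2 b0 b1 b2 x y V h0 hxy h1 ex ey).
  fold A in cut. fold B in cut.
  assert (n2' : a2 <> 0).
  { intros ->. assert (z0 : A 0 = 0) by (rewrite fac; ring).
    assert (z1 : A 1 = 0) by (rewrite fac; ring).
    assert (V0 := V 0). unfold A, quad, wronskian in *.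
    assert (a0 = 0) by lra. assert (a1 = 0) by lra. subst. lra. }
  assert (nA : forall t, t <> x -> t <> y -> A t <> 0).
  { intros t k1 k2. rewrite fac. repeat apply Rmult_integral_contrapositive_currified; lra. }
  assert (incw : forall s t, s < t -> (y < s /\ t < 1 + x) \/ (x < s /\ t < y) \/ (1 + x < s /\ t < 1 + y) ->
     wrap B s / wrap A s < wrap B t / wrap A t).
  { intros s t h [k|[k|k]].
    - destruct (Rle_or_lt t 1) as [j|j].
      + rewrite !wrap_low by lra. apply inc; [exact h|]. intros r hr. apply nA; lra.
      + rewrite !(wrap_high _ t) by lra.
        assert (J1 : B 0 / A 0 < B (t - 1) / A (t - 1)).
        { apply inc; [lra|]. intros r hr. apply nA; lra. }
        destruct (Rle_or_lt s 1) as [i|i].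
        * rewrite !(wrap_low _ s) by lra.
          assert (J2 : B s / A s <= B 1 / A 1).
          { destruct i as [i|i]; [|rewrite i; apply Rle_refl].
            left. apply inc; [exact i|]. intros r hr. apply nA; lra. }
          lra.
        * rewrite !wrap_high by lra. apply inc; [lra|]. intros r hr. apply nA; lra.
    - rewrite !wrap_low by lra. apply inc; [exact h|]. intros r hr. apply nA; lra.
    - rewrite !wrap_high by lra. apply inc; [lra|]. intros r hr. apply nA; lra. }
  assert (wA : forall t, wrap A t = wrap (fun t => a2 * ((t - x) * (t - y))) t).
  { intro t. unfold wrap. destruct Rle_dec; apply fac. }
  assert (cw1 := wrap_continuity u1 c1 e1 lo1 hi1).
  assert (cw2 := wrap_continuity u2 c2 e2 lo2 hi2).
  assert (cw3 := wrap_continuity u3 c3 e3 lo3 hi3).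
  assert (dw : forall u, (forall t, 0 < t < 1 -> is_derive u t (- (A t / u t + B t))) ->
     forall t, 0 < t < 2 -> t <> 1 ->
     is_derive (wrap u) t (- (wrap A t / wrap u t + wrap B t))).
  { intros u du t ht ne. eapply derive_eq.
    - apply (wrap_derive u (fun t => - (A t / u t + B t))); assumption.
    - unfold wrap. destruct Rle_dec; reflexivity. }
  assert (per : forall u : R -> R, u 0 = u 1 -> forall t, 0 <= t <= 1 -> wrap u t = wrap u (1 + t)).
  { intros u e t ht. rewrite wrap_low by lra. destruct (proj1 ht) as [k|<-].
    - rewrite wrap_high by lra. f_equal. ring.
    - rewrite wrap_low by lra. rewrite Rplus_0_r. exact e. }
  assert (arcs : forall a b c d, a < b -> c < d ->
     (0 < a /\ b < 2 /\ 0 < c /\ d < 2) ->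
     (forall u : R -> R, u 0 = u 1 -> wrap u a = wrap u d) ->
     (forall u : R -> R, u 0 = u 1 -> wrap u b = wrap u c) ->
     (forall t, a < t < b -> t <> 1 -> 0 < wrap A t) ->
     (forall t, c < t < d -> t <> 1 -> wrap A t < 0) ->
     (forall s t, a < s -> s < t -> t < b -> wrap B s / wrap A s < wrap B t / wrap A t) ->
     (forall s t, c < s -> s < t -> t < d -> wrap B s / wrap A s < wrap B t / wrap A t) ->
     False).
  { intros a b c d hab hcd hr gad gbc pA nA' kab kcd.
    apply (three_solution_arcs a b c d 1 (wrap A) (wrap B) (wrap u1) (wrap u2) (wrap u3)); auto;
    try (intro t; unfold wrap; destruct Rle_dec; auto; fail).
    intros t ht ne. assert (0 < t < 2) by lra. auto. }
  destruct (Rlt_or_le 0 a2) as [pa|pa].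
  + apply (arcs y (1 + x) x y); try lra; auto.
    * intros u e. symmetry. apply per; [exact e|lra].
    * intros t ht ne. rewrite wA. unfold wrap.
      destruct Rle_dec; apply Rmult_lt_0_compat; try lra; [nra|].
      assert (0 < (x - (t - 1)) * (y - (t - 1))) by (apply Rmult_lt_0_compat; lra). lra.
    * intros t ht ne. rewrite wA, wrap_low by lra.
      assert (0 < (t - x) * (y - t)) by (apply Rmult_lt_0_compat; lra). nra.
  + apply (arcs x y y (1 + x)); try lra; auto.
    * intros u e. apply per; [exact e|lra].
    * intros t ht ne. rewrite wA, wrap_low by lra.
      assert (0 < (t - x) * (y - t)) by (apply Rmult_lt_0_compat; lra). nra.
    * intros t ht ne. rewrite wA. unfold wrap. destruct Rle_dec.
      -- assert (0 < (t - x) * (t - y)) by (apply Rmult_lt_0_compat; lra). nra.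
      -- assert (0 < (x - (t - 1)) * (y - (t - 1))) by (apply Rmult_lt_0_compat; lra). nra.
- destruct (linear_sign (a1 + a2 * x) a2) as [k|k].
  + intros t ht e. apply none. exists t. split; [exact ht|exact e].
  + apply (three_solution_arcs x 1 0 x 2 A B u1 u2 u3); auto; try lra.
    * intros t ht _. assert (0 < t < 1) by lra. auto.
    * intros t ht _. rewrite fac. apply Rmult_lt_0_compat; [lra|apply k; lra].
    * intros t ht _. rewrite fac. specialize (k t ltac:(lra)). unfold L. nra.
    * intros s t g1 g2 g3. apply inc; [exact g2|]. intros r hr. rewrite fac.
      specialize (k r ltac:(lra)). unfold L. nra.
    * intros s t g1 g2 g3. apply inc; [exact g2|]. intros r hr. rewrite fac.
      specialize (k r ltac:(lra)). unfold L. nra.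
  + apply (three_solution_arcs 0 x x 1 2 A B u1 u2 u3); auto; try lra.
    * intros t ht _. assert (0 < t < 1) by lra. auto.
    * intros t ht _. rewrite fac. specialize (k t ltac:(lra)). unfold L. nra.
    * intros t ht _. rewrite fac. specialize (k t ltac:(lra)). unfold L. nra.
    * intros s t g1 g2 g3. apply inc; [exact g2|]. intros r hr. rewrite fac.
      specialize (k r ltac:(lra)). unfold L. nra.
    * intros s t g1 g2 g3. apply inc; [exact g2|]. intros r hr. rewrite fac.
      specialize (k r ltac:(lra)). unfold L. nra.
Qed.

Lemma no_three_same_sign a0 a1 a2 b0 b1 b2 u1 u2 u3 :
  (forall r, 0 < wronskian a0 a1 a2 b0 b1 b2 r) ->
  closed_recip (quad a0 a1 a2) (quad b0 b1 b2) u1 ->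
  closed_recip (quad a0 a1 a2) (quad b0 b1 b2) u2 ->
  closed_recip (quad a0 a1 a2) (quad b0 b1 b2) u3 ->
  (forall t, u1 t <> u2 t) -> (forall t, u1 t <> u3 t) -> (forall t, u2 t <> u3 t) ->
  0 < u1 0 * u2 0 -> False.
Proof.
intros V s1 s2 s3 n12 n13 n23 h0.
assert (c1 := proj1 s1). assert (z1 := proj1 (proj2 s1)).
assert (c2 := proj1 s2). assert (z2 := proj1 (proj2 s2)).
assert (h : forall t, 0 < u1 t * u2 t).
{ intro t. assert (p1 := constant_sign u1 0 t c1 z1). assert (p2 := constant_sign u2 0 t c2 z2).
  assert (0 < (u1 0 * u1 t) * (u2 0 * u2 t)) by (apply Rmult_lt_0_compat; assumption).
  apply Rmult_lt_reg_l with (1 := h0). lra. }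
assert (d : forall t, 0 < (u2 0 - u1 0) * (u2 t - u1 t)).
{ intro t. apply (constant_sign (fun t => u2 t - u1 t)); [cont|].
  intro r. specialize (n12 r). lra. }
destruct (Rlt_or_le (u1 0) (u2 0)) as [o|o].
- apply (no_three_ordered a0 a1 a2 b0 b1 b2 u1 u2 u3); auto.
  intro t. specialize (d t). nra.
- apply (no_three_ordered a0 a1 a2 b0 b1 b2 u2 u1 u3); auto.
  + intro t. rewrite Rmult_comm. apply h.
  + intro t. specialize (d t). nra.
Qed.

(** Among three nonvanishing functions two have the same sign. *)
Lemma no_three_positive a0 a1 a2 b0 b1 b2 u1 u2 u3 :
  (forall r, 0 < wronskian a0 a1 a2 b0 b1 b2 r) ->
  closed_recip (quad a0 a1 a2) (quad b0 b1 b2) u1 ->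
  closed_recip (quad a0 a1 a2) (quad b0 b1 b2) u2 ->
  closed_recip (quad a0 a1 a2) (quad b0 b1 b2) u3 ->
  (forall t, u1 t <> u2 t) -> (forall t, u1 t <> u3 t) -> (forall t, u2 t <> u3 t) ->
  False.
Proof.
intros V s1 s2 s3 n12 n13 n23.
assert (z1 := proj1 (proj2 s1) 0). assert (z2 := proj1 (proj2 s2) 0).
assert (z3 := proj1 (proj2 s3) 0).
assert (S := no_three_same_sign a0 a1 a2 b0 b1 b2).
destruct (Rlt_or_le 0 (u1 0 * u2 0)) as [h|h]; [apply (S u1 u2 u3); auto|].
destruct (Rlt_or_le 0 (u1 0 * u3 0)) as [k|k]; [apply (S u1 u3 u2); auto|].
apply (S u2 u3 u1); auto.
assert (0 < u1 0 * u1 0) by nra.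
assert (u1 0 * u2 0 <> 0) by (apply Rmult_integral_contrapositive_currified; assumption).
assert (u1 0 * u3 0 <> 0) by (apply Rmult_integral_contrapositive_currified; assumption).
apply Rmult_lt_reg_l with (1 := H). rewrite Rmult_0_r.
replace (u1 0 * u1 0 * (u2 0 * u3 0)) with ((u1 0 * u2 0) * (u1 0 * u3 0)) by ring. nra.
Qed.

Lemma no_three_nonproportional a0 a1 a2 b0 b1 b2 u1 u2 u3 :
  a0 * b1 - a1 * b0 <> 0 \/ a0 * b2 - a2 * b0 <> 0 \/ a1 * b2 - a2 * b1 <> 0 ->
  closed_recip (quad a0 a1 a2) (quad b0 b1 b2) u1 ->
  closed_recip (quad a0 a1 a2) (quad b0 b1 b2) u2 ->
  closed_recip (quad a0 a1 a2) (quad b0 b1 b2) u3 ->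
  (forall t, u1 t <> u2 t) -> (forall t, u1 t <> u3 t) -> (forall t, u2 t <> u3 t) ->
  False.
Proof.
intros m s1 s2 s3 n12 n13 n23.
set (V := wronskian a0 a1 a2 b0 b1 b2).
destruct (classic (exists t0, V t0 = 0)) as [[t0 e]|none].
- assert (D := double_root_combination a0 a1 a2 b0 b1 b2 t0).
  (* B(t0) A - A(t0) B has a double root at t0; if it is trivial, t0 is a common
     root and the coefficients B'(t0) and -A'(t0) serve instead *)
  destruct (classic (quad b0 b1 b2 t0 <> 0 \/ - quad a0 a1 a2 t0 <> 0)) as [h|h].
  + apply (D (quad b0 b1 b2 t0) (- quad a0 a1 a2 t0) u1 u2 m h); auto; [ring|].
    rewrite <- Ropp_0, <- e. unfold V, wronskian, quad. ring.
  + assert (hb : quad b0 b1 b2 t0 = 0) by (apply NNPP; tauto).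
    assert (ha : quad a0 a1 a2 t0 = 0).
    { apply NNPP. intro k. apply h. right. lra. }
    destruct (classic (b1 + 2 * b2 * t0 <> 0 \/ - (a1 + 2 * a2 * t0) <> 0)) as [k|k].
    * apply (D (b1 + 2 * b2 * t0) (- (a1 + 2 * a2 * t0)) u1 u2 m k); auto; [|ring].
      rewrite ha, hb. ring.
    * assert (kb : b1 + 2 * b2 * t0 = 0) by (apply NNPP; tauto).
      assert (ka : a1 + 2 * a2 * t0 = 0).
      { apply NNPP. intro k'. apply k. right. lra. }
      unfold quad in ha, hb.
      assert (a1 = - 2 * a2 * t0) by lra. assert (b1 = - 2 * b2 * t0) by lra. subst a1 b1.
      assert (a0 = a2 * t0 ^ 2) by lra. assert (b0 = b2 * t0 ^ 2) by lra. subst a0 b0.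
      destruct m as [m|[m|m]]; apply m; ring.
- assert (nz : forall t, V t <> 0) by (intros t e; apply none; exists t; exact e).
  assert (cV : continuity V).
  { unfold V, wronskian. intro t. apply derivable_continuous_pt, ex_derive_Reals_0.
    auto_derive. exact I. }
  assert (cs : forall t, 0 < V 0 * V t) by (intro t; apply constant_sign; assumption).
  destruct (Rlt_or_le 0 (V 0)) as [h|h].
  + apply (no_three_positive a0 a1 a2 b0 b1 b2 u1 u2 u3); auto.
    intro t. specialize (cs t). fold V. nra.
  + apply (no_three_positive a0 a1 a2 (- b0) (- b1) (- b2)
      (fun t => - u1 t) (fun t => - u2 t) (fun t => - u3 t));
      auto using closed_recip_opp.
    * intro t. specialize (cs t).
      replace (wronskian a0 a1 a2 (- b0) (- b1) (- b2) t) with (- V t)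
        by (unfold V, wronskian; ring). nra.
    * intros t e. apply (n12 t). lra.
    * intros t e. apply (n13 t). lra.
    * intros t e. apply (n23 t). lra.
Qed.

Lemma no_three_closed a0 a1 a2 b0 b1 b2 x y z :
  a0 * b1 - a1 * b0 <> 0 \/ a0 * b2 - a2 * b0 <> 0 \/ a1 * b2 - a2 * b1 <> 0 ->
  closed_solution (abel a0 a1 a2 b0 b1 b2) x ->
  closed_solution (abel a0 a1 a2 b0 b1 b2) y ->
  closed_solution (abel a0 a1 a2 b0 b1 b2) z ->
  ~ eq01 x (fun _ => 0) -> ~ eq01 y (fun _ => 0) -> ~ eq01 z (fun _ => 0) ->
  ~ eq01 x y -> ~ eq01 x z -> ~ eq01 y z -> False.
Proof.
intros m hx hy hz x0 y0 z0 xy xz yz.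
destruct (closed_solution_recip _ _ _ _ _ _ x hx x0) as [nx rx].
destruct (closed_solution_recip _ _ _ _ _ _ y hy y0) as [ny ry].
destruct (closed_solution_recip _ _ _ _ _ _ z hz z0) as [nz rz].
apply (no_three_nonproportional a0 a1 a2 b0 b1 b2 _ _ _ m rx ry rz); intros t e;
  apply Rinv_eq_reg in e; revert e.
- eapply solutions_disjoint; [apply hx|apply hy|exact xy].
- eapply solutions_disjoint; [apply hx|apply hz|exact xz].
- eapply solutions_disjoint; [apply hy|apply hz|exact yz].
Qed.

(** * Proportional coefficients *)

(** The range of x is compact, so h keeps its sign a little beyond it; this is the
room in which the solution is moved. *)
Lemma range_margin h x :
  continuity h -> continuity x -> (forall t, x t = x (clamp 0 1 t)) ->
  (forall t, h (x t) <> 0) ->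
  exists a b k tM, (forall t, a < x t <= x tM) /\ x tM < b /\
    forall v, a <= v <= b -> 0 < k * h v.
Proof.
intros ch cx cl nz.
destruct (continuity_ab_maj x 0 1) as [tM [hM _]]; [lra|intros; apply cx|].
destruct (continuity_ab_min x 0 1) as [tm [hm _]]; [lra|intros; apply cx|].
assert (rng : forall t, x tm <= x t <= x tM).
{ intro t. rewrite (cl t). assert (i := clamp_in 0 1 t ltac:(lra)). split; [apply hm|apply hM]; exact i. }
assert (chx : continuity (fun t => h (x t))) by exact (continuity_comp x h cx ch).
set (k := h (x 0)).
assert (pos : forall v, x tm <= v <= x tM -> 0 < k * h v).
{ intros v hv.
  assert (onto : exists t, x t = v).
  { assert (cg : continuity (fun t => x t - v)) by cont.
    destruct (Rle_or_lt tm tM) as [o|o].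
    - destruct (IVT_cor (fun t => x t - v) tm tM cg o) as [t [_ ht]]; [nra|exists t; lra].
    - destruct (IVT_cor (fun t => x t - v) tM tm cg ltac:(lra)) as [t [_ ht]]; [nra|exists t; lra]. }
  destruct onto as [t <-]. apply (constant_sign (fun t => h (x t))); assumption. }
assert (near : forall t, exists d, 0 < d /\ forall v, Rabs (v - x t) < d -> 0 < k * h v).
{ intro t. assert (p := pos (x t) (rng t)).
  assert (ck : continuity (fun v => k * h v)) by cont.
  destruct (continuity_near _ (x t) _ ck p) as [d [hd H]].
  exists d; split; [exact hd|]. intros v hv. specialize (H v hv). apply Rabs_def2 in H. lra. }
destruct (near tm) as [d1 [hd1 N1]]. destruct (near tM) as [d2 [hd2 N2]].
exists (x tm - d1 / 2), (x tM + d2 / 2), k, tM.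
split; [intro t; specialize (rng t); lra|]. split; [lra|]. intros v hv.
destruct (Rlt_or_le v (x tm)) as [o|o]; [apply N1, Rabs_def1; lra|].
destruct (Rlt_or_le (x tM) v) as [o'|o']; [apply N2, Rabs_def1; lra|].
apply pos; lra.
Qed.

(** With p a primitive of 1/h and g its inverse, g(p(x) + d) solves the same
equation, since p(x)' = beta does not involve x.  It is closed when x is, and it
tends to x uniformly as d tends to 0. *)
Lemma separable_not_isolated f beta h x :
  continuity beta -> continuity h -> (forall t y, f t y = beta t * h y) ->
  closed_solution f x -> (forall t, h (freeze x t) <> 0) -> ~ limit_cycle f x.
Proof.
intros cb ch hf [hx e01] nz [_ [eps [he iso]]].
assert (cx := freeze_continuity f x hx).
destruct (range_margin h (freeze x) ch cx) as [a [b [k [tM [rng [hb pos]]]]]]; [|exact nz|].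
{ intro t. unfold freeze. rewrite (clamp_id 0 1 (clamp 0 1 t)); [reflexivity|apply clamp_in; lra]. }
set (hi := freeze x tM) in *.
assert (hab : a < b) by (specialize (rng tM); fold hi in rng; lra).
set (H := fun v => k * h (clamp a b v)).
assert (cH : continuity H).
{ unfold H. apply continuity_mult; [cont|].
  apply (continuity_comp (clamp a b) h); [apply clamp_continuity; lra|exact ch]. }
assert (Hpos : forall v, 0 < H v) by (intro v; apply pos, clamp_in; lra).
assert (Hn : forall v, H v <> 0) by (intro v; specialize (Hpos v); lra).
assert (cI : continuity (fun v => / H v)) by cont.
set (p := fun v => RInt (fun w => / H w) 0 v).
assert (dp : forall v, is_derive p v (/ H v)) by exact (derive_primitive _ cI).
assert (cp : continuity p) by exact (derive_continuity _ _ dp).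
assert (ipos : forall v, 0 < / H v) by (intro v; apply Rinv_0_lt_compat, Hpos).
assert (pinc : forall v w, v < w -> p v < p w).
{ intros v w o. apply (strict_increase p v w v o cp). intros r _ _.
  exists (/ H r); split; [apply dp|apply ipos]. }
destruct (inverse_exists p a b b (fun v => / H v)) as [pab [g [cg [ga [gb [gin [gin' [ginc dg]]]]]]]];
  [exact hab|exact cp|intros; split; [apply dp|apply ipos]|].
destruct (continuity_bounded H a b) as [K hK]; [lra|exact cH|].
assert (K0 : 0 < K).
{ assert (B := hK a ltac:(lra)). apply Rlt_le_trans with (2 := B).
  apply Rabs_pos_lt, Hn. }
(* p b - p hi keeps the new solution inside [a, b]; the slope of g is at most K *)
set (d := Rmin (p b - p hi) (eps / K) / 2).
assert (d1 : 0 < p b - p hi) by (specialize (pinc hi b hb); lra).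
assert (d2 : 0 < eps / K) by (apply Rdiv_lt_0_compat; lra).
assert (d3 := Rmin_l (p b - p hi) (eps / K)). assert (d4 := Rmin_r (p b - p hi) (eps / K)).
assert (d5 : 0 < d) by (unfold d; assert (0 < Rmin (p b - p hi) (eps / K)) by (apply Rmin_glb_lt; lra); lra).
assert (d6 : d < p b - p hi /\ d < eps / K) by (unfold d in *; lra).
set (y := fun t => g (p (freeze x t) + d)).
assert (prng : forall t, p a < p (freeze x t) /\ p (freeze x t) + d < p b).
{ intro t. destruct (rng t) as [r1 [r2|r2]]; split; try (apply pinc, r1).
  - apply pinc in r2. fold hi in r2. lra.
  - rewrite r2. fold hi. lra. }
assert (py : forall t, a < y t < b /\ p (y t) = p (freeze x t) + d).
{ intro t. destruct (prng t). split; [apply gin'; lra|apply gin; lra]. }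
assert (cy : continuity y).
{ apply (continuity_comp (fun t => p (freeze x t) + d) g); [|exact cg].
  apply continuity_plus; [exact (continuity_comp _ p cx cp)|cont]. }
assert (HE : forall v, a <= v <= b -> H v = k * h v).
{ intros v hv. unfold H. rewrite clamp_id; auto. }
assert (hy : closed_solution f y).
{ split.
  - apply (solution_intro f y (fun t => beta t * h (y t))).
    + exact cy.
    + apply continuity_mult; [exact cb|exact (continuity_comp y h cy ch)].
    + intros t _. symmetry. apply hf.
    + intros t ht. destruct (prng t) as [q1 q2]. destruct (rng t) as [r1 r2].
      destruct (py t) as [y1 y2].
      eapply derive_eq.
      * apply (derive_comp g (fun t => p (freeze x t) + d)).
        -- apply dg; lra.
        -- apply (derive_plus (fun t => p (freeze x t)) (fun _ => d)); [|apply derive_const].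
           apply (derive_comp p (freeze x)); [apply dp|exact (freeze_derive f x t hx ht)].
      * fold (y t). rewrite hf, Rinv_inv, !HE by (fold hi in r2; lra).
        assert (k * h (freeze x t) <> 0) by (assert (0 < k * h (freeze x t)) by (apply pos; fold hi in r2; lra); lra).
        assert (k <> 0) by (intro k0; apply H0; rewrite k0; ring).
        field. split; [apply nz|assumption].
  - unfold y. rewrite !freeze_id by (split; lra). rewrite e01. reflexivity. }
assert (close : forall t, I01 t -> Rabs (y t - x t) < eps).
{ intros t ht. rewrite <- (freeze_id x t ht). destruct (py t) as [y1 y2].
  destruct (rng t) as [r1 r2]. fold hi in r2.
  assert (o : freeze x t < y t).
  { destruct (Rlt_or_le (freeze x t) (y t)) as [o|[o|o]]; [exact o| |].
    - apply pinc in o. lra.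
    - rewrite o in y2. lra. }
  destruct (mean_value p (freeze x t) (y t) o cp) as [c [l [hc [hl e]]]].
  { intros r _. eexists; apply dp. }
  assert (El := derive_unique _ _ _ _ hl (dp c)).
  assert (B := hK c ltac:(lra)). rewrite Rabs_pos_eq in B by (left; apply Hpos).
  rewrite Rabs_pos_eq by lra.
  assert (yx : y t - freeze x t = d * H c).
  { assert (e' : d = / H c * (y t - freeze x t)) by (rewrite <- El; lra).
    rewrite e' at 1. field. apply Hn. }
  rewrite yx. apply Rle_lt_trans with (d * K); [apply Rmult_le_compat_l; lra|].
  replace eps with (eps / K * K) by (field; lra). apply Rmult_lt_compat_r; lra. }
assert (Z := iso y hy close 0 ltac:(split; lra)).
rewrite <- (freeze_id x 0) in Z by (split; lra).
destruct (py 0) as [_ y2]. rewrite Z in y2. lra.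
Qed.

Lemma proportional_coefficients a0 a1 a2 b0 b1 b2 :
  a0 * b1 - a1 * b0 = 0 -> a0 * b2 - a2 * b0 = 0 -> a1 * b2 - a2 * b1 = 0 ->
  (b0 = 0 /\ b1 = 0 /\ b2 = 0) \/
  exists c, a0 = - c * b0 /\ a1 = - c * b1 /\ a2 = - c * b2.
Proof.
intros m01 m02 m12.
destruct (Req_dec b0 0) as [z0|n0].
2:{ right. exists (- a0 / b0). repeat split; apply (Rmult_eq_reg_r b0); auto; field_simplify; auto; lra. }
destruct (Req_dec b1 0) as [z1|n1].
2:{ right. exists (- a1 / b1). repeat split; apply (Rmult_eq_reg_r b1); auto; field_simplify; auto; lra. }
destruct (Req_dec b2 0) as [z2|n2].
2:{ right. exists (- a2 / b2). repeat split; apply (Rmult_eq_reg_r b2); auto; field_simplify; auto; lra. }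
left. auto.
Qed.

(** If B = 0 then h(x) = x^3, and no closed solution except 0 is isolated; if
A = -cB then h(x) = x^2 (1 - c x), and only 1/c remains. *)
Lemma proportional_limit_cycles a0 a1 a2 b0 b1 b2 x y :
  a0 * b1 - a1 * b0 = 0 -> a0 * b2 - a2 * b0 = 0 -> a1 * b2 - a2 * b1 = 0 ->
  limit_cycle (abel a0 a1 a2 b0 b1 b2) x -> limit_cycle (abel a0 a1 a2 b0 b1 b2) y ->
  ~ eq01 x (fun _ => 0) -> ~ eq01 y (fun _ => 0) -> eq01 x y.
Proof.
intros m01 m02 m12 lx ly x0 y0.
assert (cpow : forall n, continuity (fun v => v ^ n)).
{ intro n. apply derivable_continuous, derivable_pow. }
assert (cid : continuity (fun v => v)) by (apply derivable_continuous, derivable_id).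
destruct (proportional_coefficients _ _ _ _ _ _ m01 m02 m12) as [[-> [-> ->]]|[c [-> [-> ->]]]].
- exfalso.
  apply (separable_not_isolated (abel a0 a1 a2 0 0 0) (quad a0 a1 a2) (fun v => v ^ 3) x); [..|exact lx].
  + apply quad_continuity.
  + apply cpow.
  + intros t v. rewrite abel_quad. unfold quad. ring.
  + apply lx.
  + intros t. apply pow_nonzero. apply (closed_solution_recip _ _ _ _ _ _ x (proj1 lx) x0).
- set (f := abel _ _ _ _ _ _) in *.
  assert (sep : forall t v, f t v = quad b0 b1 b2 t * (v ^ 2 * (1 - c * v))).
  { intros t v. unfold f. rewrite abel_quad. unfold quad. ring. }
  assert (W : forall z, limit_cycle f z -> ~ eq01 z (fun _ => 0) ->
     c <> 0 /\ eq01 z (fun _ => / c)).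
  { intros z lz z0. destruct (classic (c <> 0 /\ eq01 z (fun _ => / c))) as [h|h]; [exact h|exfalso].
    assert (nz := proj1 (closed_solution_recip _ _ _ _ _ _ z (proj1 lz) z0)).
    apply (separable_not_isolated f (quad b0 b1 b2) (fun v => v ^ 2 * (1 - c * v)) z);
      [apply quad_continuity|cont; apply cpow|exact sep|apply lz| |exact lz].
    intros t. apply Rmult_integral_contrapositive_currified; [apply pow_nonzero, nz|].
    intro e. assert (c0 : c <> 0) by (intros ->; lra).
    apply h. split; [exact c0|]. apply NNPP. intro ne.
    apply (solutions_disjoint _ _ _ _ _ _ z (fun _ => / c) (proj1 (proj1 lz))) with t.
    + apply constant_solution. intro s. fold f. rewrite sep. field. exact c0.
    + exact ne.
    + unfold freeze at 2. apply (Rmult_eq_reg_l c); [|exact c0]. rewrite Rinv_r by exact c0. lra. }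
  destruct (W x lx x0) as [_ ex]. destruct (W y ly y0) as [_ ey].
  exact (eq01_trans _ _ _ ex (eq01_sym _ _ ey)).
Qed.

(** * The upper bound *)

Lemma no_three_limit_cycles a0 a1 a2 b0 b1 b2 x y z :
  limit_cycle (abel a0 a1 a2 b0 b1 b2) x ->
  limit_cycle (abel a0 a1 a2 b0 b1 b2) y ->
  limit_cycle (abel a0 a1 a2 b0 b1 b2) z ->
  ~ eq01 x (fun _ => 0) -> ~ eq01 y (fun _ => 0) -> ~ eq01 z (fun _ => 0) ->
  ~ eq01 x y -> ~ eq01 x z -> ~ eq01 y z -> False.
Proof.
intros lx ly lz x0 y0 z0 xy xz yz.
destruct (classic (a0 * b1 - a1 * b0 <> 0 \/ a0 * b2 - a2 * b0 <> 0 \/ a1 * b2 - a2 * b1 <> 0))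
  as [m|m].
- exact (no_three_closed _ _ _ _ _ _ x y z m (proj1 lx) (proj1 ly) (proj1 lz) x0 y0 z0 xy xz yz).
- apply xy. apply (proportional_limit_cycles a0 a1 a2 b0 b1 b2); auto; apply NNPP; tauto.
Qed.

Lemma at_most_three_limit_cycles a0 a1 a2 b0 b1 b2 :
  at_most 3 (limit_cycle (abel a0 a1 a2 b0 b1 b2)).
Proof.
intros l hl hd.
destruct l as [|w [|x [|y [|z l]]]]; try (simpl; lia). exfalso.
repeat match goal with
| h : List.Forall _ (_ :: _) |- _ => inversion h; subst; clear h
| h : pairwise_distinct (_ :: _) |- _ => inversion h; subst; clear h
| h : ForallOrdPairs _ (_ :: _) |- _ => inversion h; subst; clear h
end.
assert (S : forall u v, ~ eq01 u v -> eq01 u (fun _ => 0) -> ~ eq01 v (fun _ => 0)).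
{ intros u v n hu hv. apply n. exact (eq01_trans _ _ _ hu (eq01_sym _ _ hv)). }
assert (N := no_three_limit_cycles a0 a1 a2 b0 b1 b2).
destruct (classic (eq01 w (fun _ => 0))) as [hw|hw];
  [apply (N x y z); try assumption; apply (S w); assumption|].
destruct (classic (eq01 x (fun _ => 0))) as [hx|hx];
  [apply (N w y z); try assumption; apply (S x); assumption|].
destruct (classic (eq01 y (fun _ => 0))) as [hy|hy];
  [apply (N w x z); try assumption; apply (S y); assumption|].
apply (N w x y); assumption.
Qed.

(** * An equation with three limit cycles *)

(** Picard iteration, in the uniform distance on the whole line. *)
Lemma contraction_fixed_point (T : (R -> R) -> R -> R) (u0 : R -> R) (D : R) :
  (forall u, continuity u -> continuity (T u)) ->
  (forall u w e, continuity u -> continuity w ->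
     (forall t, Rabs (u t - w t) <= e) -> forall t, Rabs (T u t - T w t) <= e / 2) ->
  continuity u0 -> (forall t, Rabs (T u0 t - u0 t) <= D) ->
  exists u, continuity u /\ forall t, u t = T u t.
Proof.
intros cT lipT c0 hD.
set (s := fix s n := match n with O => u0 | S k => T (s k) end).
assert (cs : forall n, continuity (s n)) by (induction n; simpl; auto).
assert (step : forall n t, Rabs (s (S n) t - s n t) <= D * (/ 2) ^ n).
{ induction n as [|n IH]; intro t; [simpl; rewrite Rmult_1_r; apply hD|].
  assert (L := lipT (s (S n)) (s n) _ (cs (S n)) (cs n) IH t).
  simpl in *. lra. }
assert (D0 : 0 <= D) by (eapply Rle_trans; [apply Rabs_pos|apply (hD 0)]).
assert (q0 : forall n, 0 < (/ 2) ^ n) by (intro n; apply pow_lt; lra).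
assert (far : forall n k t, Rabs (s (n + k)%nat t - s n t) <= 2 * D * (/ 2) ^ n - 2 * D * (/ 2) ^ (n + k)).
{ intros n k t. induction k as [|k IH].
  - rewrite Nat.add_0_r, !Rminus_diag, Rabs_R0. lra.
  - rewrite Nat.add_succ_r. assert (B := step (n + k)%nat t).
    replace (s (S (n + k)) t - s n t)
      with ((s (S (n + k)) t - s (n + k)%nat t) + (s (n + k)%nat t - s n t)) by ring.
    eapply Rle_trans; [apply Rabs_triang|]. simpl pow. lra. }
assert (small : forall e, 0 < e -> exists n, 2 * D * (/ 2) ^ n < e).
{ intros e he. destruct (pow_lt_1_zero (/ 2)) with (y := e / (2 * D + 1)) as [N hN].
  - rewrite Rabs_pos_eq; lra.
  - apply Rdiv_lt_0_compat; lra.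
  - exists N. specialize (hN N (Nat.le_refl _)). rewrite Rabs_pos_eq in hN by (left; apply q0).
    apply Rmult_lt_compat_l with (r := 2 * D + 1) in hN; [|lra].
    replace ((2 * D + 1) * (e / (2 * D + 1))) with e in hN by (field; lra).
    specialize (q0 N). nra. }
assert (lim : forall t, exists l, is_lim_seq (fun n => s n t) (Finite l)).
{ intro t. apply ex_lim_seq_cauchy_corr. intros [e he].
  destruct (small (e / 2)) as [N hN]; [lra|]. exists N. intros n m hn hm. simpl.
  replace n with (N + (n - N))%nat by lia. replace m with (N + (m - N))%nat by lia.
  assert (B1 := far N (n - N)%nat t). assert (B2 := far N (m - N)%nat t).
  assert (Q1 := q0 (N + (n - N))%nat). assert (Q2 := q0 (N + (m - N))%nat).
  assert (0 <= 2 * D * (/ 2) ^ (N + (n - N))) by (apply Rmult_le_pos; lra).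
  assert (0 <= 2 * D * (/ 2) ^ (N + (m - N))) by (apply Rmult_le_pos; lra).
  apply Rabs_le_between in B1. apply Rabs_le_between in B2. apply Rabs_def1; lra. }
set (u := fun t => proj1_sig (constructive_indefinite_description _ (lim t))).
assert (ul : forall t, is_lim_seq (fun n => s n t) (Finite (u t))).
{ intro t. unfold u. apply proj2_sig. }
assert (ub : forall n t, Rabs (u t - s n t) <= 2 * D * (/ 2) ^ n).
{ intros n t. assert (L := is_lim_seq_incr_n (fun k => s k t) n (Finite (u t))).
  apply L in ul. clear L.
  assert (C : forall k, s n t - 2 * D * (/ 2) ^ n <= s (k + n)%nat t <= s n t + 2 * D * (/ 2) ^ n).
  { intro k. rewrite Nat.add_comm. assert (B := far n k t). assert (Q := q0 (n + k)%nat).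
    assert (0 <= 2 * D * (/ 2) ^ (n + k)) by (apply Rmult_le_pos; lra).
    apply Rabs_le_between in B. lra. }
  assert (lo := is_lim_seq_le (fun _ => s n t - 2 * D * (/ 2) ^ n) _ _ _
    (fun k => proj1 (C k)) (is_lim_seq_const _) (ul)).
  assert (up := is_lim_seq_le _ (fun _ => s n t + 2 * D * (/ 2) ^ n) _ _
    (fun k => proj2 (C k)) (ul) (is_lim_seq_const _)).
  simpl in lo, up. apply Rabs_le_between. lra. }
assert (cu : continuity u).
{ intros t e he. destruct (small (e / 3)) as [n hn]; [lra|].
  destruct (continuity_near (s n) t (e / 3) (cs n)) as [d [hd near]]; [lra|].
  exists d; split; [exact hd|]. intros r [_ hr].
  unfold dist in *; simpl in *; unfold R_dist in *.
  assert (B1 := ub n t). assert (B2 := ub n r). specialize (near r hr).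
  apply Rabs_le_between in B1. apply Rabs_le_between in B2. apply Rabs_def2 in near.
  apply Rabs_def1; lra. }
exists u; split; [exact cu|]. intro t.
apply cond_eq. intros e he. destruct (small (e / 2)) as [n hn]; [lra|].
assert (B1 := ub (S n) t). assert (B2 := lipT u (s n) _ cu (cs n) (ub n) t).
simpl in B1. assert (Q := q0 n). assert (0 <= 2 * D * (/ 2) ^ n) by (apply Rmult_le_pos; lra).
apply Rabs_le_between in B1. apply Rabs_le_between in B2. apply Rabs_def1; lra.
Qed.

(** The term A/u for A = t - 1/2, truncated below u = 2 so that it is Lipschitz in u;
the solution constructed stays above 2. *)
Definition drift (u : R -> R) (s : R) : R := (s - 1 / 2) / Rmax (u s) 2.

Lemma Rmax_continuity u : continuity u -> continuity (fun s => Rmax (u s) 2).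
Proof.
intros cu t. apply (continuity_pt_ext (fun s => (u s + 2 + Rabs (u s - 2)) / 2)).
- intro s. unfold Rmax, Rabs. destruct Rle_dec, Rcase_abs; lra.
- unfold Rdiv. apply continuity_mult; [|cont]. apply continuity_plus; [cont|].
  apply (continuity_comp (fun s => u s - 2) Rabs); [cont|exact Rcontinuity_abs].
Qed.

Lemma drift_continuity u : continuity u -> continuity (drift u).
Proof.
intro cu. unfold drift. apply continuity_div.
- apply continuity_minus; [apply derivable_continuous, derivable_id|cont].
- apply Rmax_continuity, cu.
- intro s. assert (h := Rmax_r (u s) 2). lra.
Qed.

Lemma integral_bound f M t :
  continuity f -> 0 <= t <= 1 -> (forall s, 0 <= s <= 1 -> Rabs (f s) <= M) ->
  Rabs (RInt f 0 t) <= M.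
Proof.
intros cf ht hM.
assert (M0 : 0 <= M) by (eapply Rle_trans; [apply Rabs_pos|apply (hM 0); lra]).
apply Rle_trans with ((t - 0) * M).
- apply abs_RInt_le_const; [lra| |intros; apply hM; lra].
  apply (ex_RInt_continuous f). intros s _. apply continuity_pt_filterlim, cf.
- nra.
Qed.

Lemma drift_bound u s : 0 <= s <= 1 -> Rabs (drift u s) <= 1 / 4.
Proof.
intro hs. unfold drift. assert (h := Rmax_r (u s) 2).
unfold Rdiv. rewrite Rabs_mult, Rabs_inv, (Rabs_pos_eq (Rmax _ _)) by lra.
assert (Rabs (s - 1 * / 2) <= 1 / 2) by (apply Rabs_le_between; lra).
assert (/ Rmax (u s) 2 <= / 2) by (apply Rinv_le_contravar; lra).
assert (0 < / Rmax (u s) 2) by (apply Rinv_0_lt_compat; lra).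
assert (0 <= Rabs (s - 1 * / 2)) by apply Rabs_pos. nra.
Qed.

Lemma drift_contract u w s e :
  0 <= s <= 1 -> Rabs (u s - w s) <= e -> Rabs (drift u s - drift w s) <= e / 8.
Proof.
intros hs he. unfold drift.
assert (h1 := Rmax_r (u s) 2). assert (h2 := Rmax_r (w s) 2).
assert (h : Rabs (Rmax (w s) 2 - Rmax (u s) 2) <= e).
{ apply Rle_trans with (2 := he). unfold Rmax.
  repeat destruct Rle_dec; unfold Rabs; repeat destruct Rcase_abs; lra. }
set (a := Rmax (u s) 2) in *. set (b := Rmax (w s) 2) in *.
replace ((s - 1 / 2) / a - (s - 1 / 2) / b) with ((s - 1 / 2) * (b - a) * / (a * b)) by (field; lra).
rewrite !Rabs_mult, Rabs_inv, (Rabs_pos_eq (a * b)) by nra.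
assert (H1 : Rabs (s - 1 / 2) <= 1 / 2) by (apply Rabs_le_between; lra).
assert (H2 : / (a * b) <= / 4) by (apply Rinv_le_contravar; nra).
assert (H3 : 0 < / (a * b)) by (apply Rinv_0_lt_compat; nra).
assert (H4 := Rabs_pos (s - 1 / 2)). assert (H5 := Rabs_pos (b - a)).
assert (Rabs (s - 1 / 2) * Rabs (b - a) <= 1 / 2 * e) by (apply Rmult_le_compat; lra).
assert (0 <= Rabs (s - 1 / 2) * Rabs (b - a)) by (apply Rmult_le_pos; lra).
apply Rle_trans with (1 / 2 * e * / 4); [apply Rmult_le_compat; lra|lra].
Qed.

Lemma cube_bound v : -1 / 2 <= v <= 1 / 2 -> - 1 / 8 <= v ^ 3 <= 1 / 8.
Proof.
intro h.
assert (0 <= (v + 1 / 2) * ((v - 1 / 4) ^ 2 + 3 / 16)).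
{ apply Rmult_le_pos; [lra|]. assert (q := pow2_ge_0 (v - 1 / 4)). lra. }
assert (0 <= (1 / 2 - v) * ((v + 1 / 4) ^ 2 + 3 / 16)).
{ apply Rmult_le_pos; [lra|]. assert (q := pow2_ge_0 (v + 1 / 4)). lra. }
lra.
Qed.

(** Let J(t) be the integral of (s - 1/2)/u from 0 to t.  Integrating
u' = -((t - 1/2)/u + be + 12 (t - 1/2)^2) from u(0) = 6 and requiring u(1) = 6
forces be = -1 - J(1), so u is a fixed point of
  u -> 6 - J(t) + (1 + J(1)) t - (4 (t - 1/2)^3 + 1/2).
The initial value 6 is large enough for u >= 2, which makes the map a
contraction. *)
Lemma symmetric_family_closed :
  exists be x, closed_solution (abel (- 1 / 2) 1 0 (be + 3) (- 12) 12) x /\ 0 < x 0.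
Proof.
set (J := fun u t => RInt (drift u) 0 t).
set (c := clamp 0 1).
assert (cin : forall t, 0 <= c t <= 1) by (intro t; apply clamp_in; lra).
assert (cc : continuity c) by (apply clamp_continuity; lra).
assert (dJ : forall u, continuity u -> forall t, is_derive (J u) t (drift u t)).
{ intros u cu. exact (derive_primitive _ (drift_continuity u cu)). }
assert (cJ : forall u, continuity u -> continuity (J u)).
{ intros u cu. exact (derive_continuity _ _ (dJ u cu)). }
assert (bJ : forall u t, continuity u -> 0 <= t <= 1 -> Rabs (J u t) <= 1 / 4).
{ intros u t cu ht. apply integral_bound; [apply drift_continuity, cu|exact ht|].
  intros s hs. apply drift_bound, hs. }
assert (lJ : forall u w e t, continuity u -> continuity w -> (forall s, Rabs (u s - w s) <= e) ->
   0 <= t <= 1 -> Rabs (J u t - J w t) <= e / 8).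
{ intros u w e t cu cw he ht. unfold J.
  assert (ex : forall v, continuity v -> ex_RInt (drift v) 0 t).
  { intros v cv. apply (ex_RInt_continuous (drift v)). intros s _.
    apply continuity_pt_filterlim, drift_continuity, cv. }
  assert (E := RInt_minus (drift u) (drift w) 0 t (ex u cu) (ex w cw)).
  unfold minus, plus, opp in E; simpl in E.
  replace (RInt (drift u) 0 t - RInt (drift w) 0 t) with
    (RInt (fun s => drift u s + - drift w s) 0 t) by (rewrite E; reflexivity).
  apply integral_bound; [|exact ht|].
  - apply continuity_plus; [|apply continuity_opp]; apply drift_continuity; assumption.
  - intros s hs. apply drift_contract; [exact hs|apply he]. }
set (T := fun u t => 6 - J u (c t) + (1 + J u 1) * c t - (4 * (c t - 1 / 2) ^ 3 + 1 / 2)).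
assert (cpow : continuity (fun t => (c t - 1 / 2) ^ 3)).
{ apply (continuity_comp (fun t => c t - 1 / 2) (fun v => v ^ 3)); [cont|].
  apply derivable_continuous, derivable_pow. }
destruct (contraction_fixed_point T (fun _ => 6) 8) as [u [cu hu]].
- intros u cu. assert (cJc : continuity (fun t => J u (c t))) by exact (continuity_comp c _ cc (cJ u cu)).
  unfold T. cont.
- intros u w e cu cw he t. unfold T.
  assert (B1 := lJ u w e (c t) cu cw he (cin t)).
  assert (B2 := lJ u w e 1 cu cw he ltac:(lra)).
  replace (6 - J u (c t) + (1 + J u 1) * c t - (4 * (c t - 1 / 2) ^ 3 + 1 / 2) -
    (6 - J w (c t) + (1 + J w 1) * c t - (4 * (c t - 1 / 2) ^ 3 + 1 / 2)))
    with ((J u 1 - J w 1) * c t - (J u (c t) - J w (c t))) by ring.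
  specialize (cin t). apply Rabs_le_between in B1. apply Rabs_le_between in B2.
  assert (0 <= e) by lra. apply Rabs_le_between. nra.
- cont.
- intro t. unfold T. set (u := fun _ : R => 6) in *. assert (cu : continuity u) by (unfold u; cont).
  assert (B1 := bJ u (c t) cu (cin t)). assert (B2 := bJ u 1 cu ltac:(lra)).
  specialize (cin t). apply Rabs_le_between in B1. apply Rabs_le_between in B2.
  assert (- 1 / 8 <= (c t - 1 / 2) ^ 3 <= 1 / 8) by (apply cube_bound; lra).
  change (u t) with 6. assert (0 <= (1 + J u 1) * c t <= 5 / 4) by nra.
  apply Rabs_le_between. lra.
- assert (B := bJ u 1 cu ltac:(lra)). apply Rabs_le_between in B.
  assert (u2 : forall t, 2 <= u t).
  { intro t. rewrite hu. unfold T. assert (B1 := bJ u (c t) cu (cin t)).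
    specialize (cin t). apply Rabs_le_between in B1.
    assert (h3 := cube_bound (c t - 1 / 2) ltac:(lra)).
    assert (0 <= (1 + J u 1) * c t) by nra. lra. }
  assert (nu : forall t, u t <> 0) by (intro t; specialize (u2 t); lra).
  exists (- 1 - J u 1), (fun t => / u t).
  split; [split|].
  + apply (solution_intro _ _ (fun t =>
      quad (- 1 / 2) 1 0 t * (/ u t) ^ 3 + quad (- 1 - J u 1 + 3) (- 12) 12 t * (/ u t) ^ 2)).
    * cont.
    * assert (ci : continuity (fun t => / u t)) by cont.
      assert (cp : forall n, continuity (fun t => (/ u t) ^ n)).
      { intro n. apply (continuity_comp (fun t => / u t) (fun v => v ^ n)); [exact ci|].
        apply derivable_continuous, derivable_pow. }
      apply continuity_plus; apply continuity_mult; auto using quad_continuity.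
    * reflexivity.
    * intros t ht.
      assert (du : is_derive u t (- drift u t + (1 + J u 1) - 12 * (t - 1 / 2) ^ 2)).
      { apply (is_derive_ext_loc
          (fun t => 6 - J u t + (1 + J u 1) * t - (4 * (t - 1 / 2) ^ 3 + 1 / 2))).
        - assert (hd : 0 < Rmin t (1 - t)) by (apply Rmin_glb_lt; lra).
          exists (mkposreal _ hd). intros s hs.
          assert (k3 := Rmin_l t (1 - t)). assert (k4 := Rmin_r t (1 - t)).
          apply Rabs_def2 in hs. unfold minus, plus, opp in hs; simpl in hs.
          rewrite (hu s). unfold T, c. rewrite clamp_id by lra. reflexivity.
        - eapply derive_eq.
          + apply (derive_minus (fun t => 6 - J u t + (1 + J u 1) * t)).
            * apply (derive_plus (fun t => 6 - J u t) (fun t => (1 + J u 1) * t)).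
              -- apply (derive_minus (fun _ => 6) (J u)); [apply derive_const|apply dJ, cu].
              -- apply (derive_mult (fun _ => 1 + J u 1) (fun t => t));
                   [apply derive_const|apply is_derive_id].
            * auto_derive; [exact I|reflexivity].
          + simpl. unfold one; simpl. field. }
      eapply derive_eq; [apply is_derive_inv; [exact du|apply nu]|].
      unfold drift, quad. rewrite Rmax_left by apply u2. simpl. field. apply nu.
  + rewrite (hu 0), (hu 1). unfold T, c. rewrite !clamp_id by lra.
    apply (f_equal Rinv). unfold J. rewrite RInt_point. unfold zero; simpl. field.
  + apply Rinv_0_lt_compat. specialize (u2 0). lra.
Qed.

Lemma reversed_closed_solution be x :
  closed_solution (abel (- 1 / 2) 1 0 (be + 3) (- 12) 12) x ->
  closed_solution (abel (- 1 / 2) 1 0 (be + 3) (- 12) 12) (fun t => - freeze x (1 - t)).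
Proof.
intros [hx e].
assert (cr : continuity (fun t => 1 - t)).
{ apply continuity_minus; [cont|apply derivable_continuous, derivable_id]. }
assert (cy : continuity (fun t => - freeze x (1 - t))).
{ apply continuity_opp. exact (continuity_comp _ _ cr (freeze_continuity _ _ hx)). }
split.
- apply (solution_intro _ _ (fun t => quad (- 1 / 2) 1 0 t * (- freeze x (1 - t)) ^ 3
    + quad (be + 3) (- 12) 12 t * (- freeze x (1 - t)) ^ 2)).
  + exact cy.
  + assert (cp : forall n, continuity (fun t => (- freeze x (1 - t)) ^ n)).
    { intro n. apply (continuity_comp (fun t => - freeze x (1 - t)) (fun v => v ^ n)); [exact cy|].
      apply derivable_continuous, derivable_pow. }
    apply continuity_plus; apply continuity_mult; auto using quad_continuity.
  + reflexivity.
  + intros t ht. eapply derive_eq.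
    * apply (is_derive_opp (fun t => freeze x (1 - t))).
      apply (derive_comp (freeze x) (fun t => 1 - t)).
      -- apply (freeze_derive _ x (1 - t) hx). lra.
      -- apply (derive_minus (fun _ => 1) (fun t => t)); [apply derive_const|apply is_derive_id].
    * rewrite abel_quad. unfold opp, one, quad; simpl. field.
- rewrite !freeze_id by (split; lra). rewrite Rminus_0_r, Rminus_diag, e. reflexivity.
Qed.

(** The three closed solutions have the initial values 0, x(0) and -x(0), so each is
isolated at distance x(0). *)
Lemma exactly_three_of_pair a0 a1 a2 b0 b1 b2 x y :
  a0 * b1 - a1 * b0 <> 0 \/ a0 * b2 - a2 * b0 <> 0 \/ a1 * b2 - a2 * b1 <> 0 ->
  closed_solution (abel a0 a1 a2 b0 b1 b2) x ->
  closed_solution (abel a0 a1 a2 b0 b1 b2) y ->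
  0 < x 0 -> y 0 = - x 0 ->
  limit_cycle (abel a0 a1 a2 b0 b1 b2) (fun _ => 0) /\
  exactly 3 (limit_cycle (abel a0 a1 a2 b0 b1 b2)).
Proof.
intros m hx hy px ey. set (f := abel a0 a1 a2 b0 b1 b2) in *.
assert (i0 : I01 0) by (split; lra).
assert (hz : closed_solution f (fun _ => 0)).
{ split; [|reflexivity]. apply constant_solution. intro t. unfold f. rewrite abel_quad. ring. }
assert (sep : forall u v : R -> R, u 0 <> v 0 -> ~ eq01 u v).
{ intros u v n e. apply n, e, i0. }
assert (all : forall u, closed_solution f u -> eq01 u (fun _ => 0) \/ eq01 u x \/ eq01 u y).
{ intros u hu. apply NNPP. intro n.
  apply (no_three_closed a0 a1 a2 b0 b1 b2 u x y m hu hx hy); try tauto; apply sep; lra. }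
assert (lim : forall u, closed_solution f u -> limit_cycle f u).
{ intros u hu. split; [exact hu|]. exists (x 0). split; [exact px|]. intros v hv close.
  specialize (close 0 i0). apply Rabs_def2 in close.
  destruct (all u hu) as [e|[e|e]], (all v hv) as [k|[k|k]];
    try exact (eq01_trans _ _ _ k (eq01_sym _ _ e));
    exfalso; assert (e0 := e 0 i0); assert (k0 := k 0 i0); simpl in *; lra. }
split; [apply lim, hz|].
exists ((fun _ => 0) :: x :: y :: nil). split; [reflexivity|]. split.
- repeat constructor; apply sep; lra.
- assert (closed_ext : forall u v, eq01 u v -> closed_solution f v -> closed_solution f u).
  { intros u v e [hv ev]. split.
    - exact (is_solution_ext f u v e hv).
    - rewrite (e 0), (e 1); [exact ev| |exact i0]. split; lra. }
  intro u. split.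
  + intros [hu _]. destruct (all u hu) as [e|[e|e]]; [left|right; left|right; right; left]; exact e.
  + intro h. apply lim.
    repeat match goal with
    | h : List.Exists _ (_ :: _) |- _ => inversion h; subst; clear h
    | h : List.Exists _ nil |- _ => inversion h
    end; eapply closed_ext; eassumption.
Qed.

Theorem theorem3 :
  (forall a0 a1 a2 b0 b1 b2 : R,
     at_most 3 (limit_cycle (abel a0 a1 a2 b0 b1 b2))) /\
  (exists a0 a1 a2 b0 b1 b2 : R,
     limit_cycle (abel a0 a1 a2 b0 b1 b2) (fun _ => 0) /\
     exactly 3 (limit_cycle (abel a0 a1 a2 b0 b1 b2))).
Proof.
split; [exact at_most_three_limit_cycles|].
destruct symmetric_family_closed as [be [x [hx px]]].
exists (- 1 / 2), 1, 0, (be + 3), (- 12), 12.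
apply (exactly_three_of_pair _ _ _ _ _ _ x (fun t => - freeze x (1 - t))).
- right; left. lra.
- exact hx.
- apply reversed_closed_solution, hx.
- exact px.
- rewrite freeze_id by (split; lra). rewrite Rminus_0_r, (proj2 hx). reflexivity.
Qed.
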